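(* Let $(C,F,D,G)$ be the data of a hybrid inclusion on $\mathbb R^n$ satisfying the Hybrid Basic Conditions and let $(\phi,\{h_k\}_{k=1}^\infty)$ be an asymptotic simulation of the hybrid inclusion. Then the compressed-domain version $\widetilde\phi$ of $\phi$ is an asymptotic solution of the hybrid inclusion, and the interpolated mapping $\psi$ of $(\phi,\{h_k\})$ is a vanishing inflation solution and an asymptotic solution of the hybrid inclusion.
   Context: $\mathbb B$ is the closed unit ball. A hybrid time domain is the union of a nondecreasing sequence of sets $\bigcup_{i=0}^{J-1}[t_i,t_{i+1}]\times\{i\}$ with $J\ge1$, $0=t_0\le\dots\le t_J$. A hybrid arc is a function $\xi:\mathrm{dom}\,\xi\to\mathbb R^n$ on a hybrid time domain with $t\mapsto\xi(t,j)$ absolutely continuous on $[t,t']$ whenever $(t,j),(t',j)\in\mathrm{dom}\,\xi$, $t<t'$; it is complete if its domain is unbounded. Hybrid inclusion with data $(C,F,D,G)$: $x\in C,\ \dot x\in F(x)$; $x\in D,\ x^+\in G(x)$, with $C,D\subset\mathbb R^n$, $F,G:\mathbb R^n\rightrightarrows\mathbb R^n$. Hybrid Basic Conditions: $C,D$ closed; $F,G$ outer semicontinuous and locally bounded; $F(x)$ nonempty and convex for $x\in C$; $G(x)$ nonempty for $x\in D$. A solution is a hybrid arc $\xi$ with $\xi(0,0)\in C\cup D$ such that: whenever $[t,t']\times\{j\}\subset\mathrm{dom}\,\xi$, $t<t'$, $\xi(r,j)\in C$ and $\dot\xi(r,j)\in F(\xi(r,j))$ for almost all $r\in[t,t']$;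 whenever $(t,j),(t,j+1)\in\mathrm{dom}\,\xi$, $\xi(t,j)\in D$ and $\xi(t,j+1)\in G(\xi(t,j))$. $\mathcal S_{\mathcal H}$ is the set of solutions. For a (possibly set-valued) mapping $\xi$ with $\mathrm{dom}\,\xi\subset[0,\infty)^2$ and $(s,i)\in\mathrm{dom}\,\xi$, the tail $\xi^{(s,i)}$ has domain $\{(t,j)\in[0,\infty)^2:(s+t,i+j)\in\mathrm{dom}\,\xi\}$ and values $\xi(s+t,i+j)$. Graphical convergence means Painlevé–Kuratowski set convergence of graphs in $\mathbb R^{n+2}$. Such a $\xi$ is an asymptotic solution of the hybrid inclusion if it is bounded, has unbounded domain, and for every graphically convergent sequence of tails $\xi^{(t_i,j_i)}$ with $(t_i,j_i)\in\mathrm{dom}\,\xi$, $t_i+j_i\to\infty$, the graphical limit is a complete element of $\mathcal S_{\mathcal H}$. For $\varepsilon>0$ the $\varepsilon$-inflated system is the hybrid inclusion with data $C_\varepsilon=C+\varepsilon\mathbb B$, $F_\varepsilon(x)=\overline{\mathrm{co}}\,F((x+\varepsilon\mathbb B)\cap C)+\varepsilon\mathbb B$ for $x\in C_\varepsilon$, $D_\varepsilon=D+\varepsilon\mathbb B$, $G_\varepsilon(x)=G((x+\varepsilon\mathbb B)\cap D)+\varepsilon\mathbb B$ for $x\in D_\varepsilon$. For a complete, bounded hybrid arc $\psi$, $\mathcal P(\psi)$ is the class of functions $\chi:\mathrm{dom}\,\chi\to\mathbb R^n$ such that (i) $\mathrm{dom}\,\chi=\{(s,i,t,j):(s,i),(t,j)\in\mathrm{dom}\,\psi,\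 s+i\le t+j\}$; (ii) if $(s,i,t_1,j),(s,i,t_2,j)\in\mathrm{dom}\,\chi$ with $t_2>t_1$, then $t\mapsto\chi(s,i,t,j)$ is absolutely continuous on $[t_1,t_2]$; (iii) for each $\tau>0$, $\lim_{s+i\to\infty}\sup\{|\chi(s,i,t,j)|:(s,i,t,j)\in\mathrm{dom}\,\chi,\ 0\le t+j-(s+i)\le\tau\}=0$. A complete, bounded hybrid arc $\psi$ is a vanishing inflation solution if there exists $\chi\in\mathcal P(\psi)$ and, for each $\varepsilon,T>0$, there exists $\kappa>0$ such that for each $(s,i)\in\mathrm{dom}\,\psi$ with $s+i\ge\kappa$ the mapping with domain $\mathrm{dom}\,\psi^{(s,i)}\cap\{(t,j)\in\mathbb R_{\ge0}\times\mathbb Z_{\ge0}:t+j\le T\}$ and values $\psi^{(s,i)}(t,j)+\chi(s,i,s+t,i+j)$ is a solution of the $\varepsilon$-inflated system. A hybrid sequence domain is the union of a nondecreasing sequence of sets $\bigcup_{i=0}^{J-1}\{k_i,\dots,k_{i+1}\}\times\{i\}$ with $J\ge1$, integers $0=k_0\le\dots\le k_J$. A hybrid sequence is a mapping $\phi:\mathrm{dom}\,\phi\to\mathbb R^n$ on a hybrid sequence domain; it is complete if its domain is unbounded, complete in the $k$ (resp. $j$) direction if the set of first (resp. second) coordinates of the domain is unbounded. $\overline{\jmath}_k:=\inf\{j\in\mathbb Z_{\ge0}:(k+1,j)\in\mathrm{dom}\,\phi\}$, $\overline k_j:=\inf\{k\in\mathbb Z_{\ge0}:(k,j+1)\in\mathrm{dom}\,\phi\}$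 ($\inf\emptyset=\infty$). $\{h_k\}_{k=1}^\infty$ is admissible if $h_k>0$, $h_k\to0$, $\sum_kh_k=\infty$; $\tau_k:=\sum_{i=0}^{k-1}h_{i+1}$, $m(t):=\max\{k\in\mathbb Z_{\ge0}:\tau_k\le t\}$. $(\phi,\{h_k\})$ is an asymptotic simulation if $\{h_k\}$ is admissible, $\phi$ is bounded and complete and: (1) if $\phi$ is complete in the $k$ direction, there is a bounded sequence $\{f_k\}_{k=0}^\infty$ in $\mathbb R^n$ with $\limsup_{k\to\infty}(\phi(k,\overline{\jmath}_k),f_k)\subset\mathrm{graph}(F)\cap(C\times\mathbb R^n)$ and, with $\widehat f_{k+1}:=(\phi(k+1,\overline{\jmath}_k)-\phi(k,\overline{\jmath}_k))/h_{k+1}$, for some $T>0$, $\lim_{k\to\infty}\sup_{k+1\le\ell\le m(\tau_k+T)}|\sum_{i=k}^{\ell-1}h_{i+1}(\widehat f_{i+1}-f_i)|=0$; (2) if $\phi$ is complete in the $j$ direction, $\limsup_{j\to\infty}(\phi(\overline k_j,j),\phi(\overline k_j,j+1))\subset\mathrm{graph}(G)\cap(D\times\mathbb R^n)$. Here $\limsup$ is the set of accumulation points. The compressed-domain version $\widetilde\phi$ has $\mathrm{dom}\,\widetilde\phi=\{(\tau_k,j):(k,j)\in\mathrm{dom}\,\phi\}$ and $\widetilde\phi(\tau_k,j)=\phi(k,j)$. The interpolated mapping $\psi$ has $\mathrm{dom}\,\psi=\bigcup\{[t,t']\times\{j\}:(t,j),(t',j)\in\mathrm{dom}\,\widetilde\phi\}$;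 if $(k,j),(k+1,j)\in\mathrm{dom}\,\phi$ then $\psi(t,j)=\phi(k,j)+\frac{t-\tau_k}{h_{k+1}}(\phi(k+1,j)-\phi(k,j))$ for $t\in[\tau_k,\tau_{k+1}]$; if $(k,j),(k,j+1)\in\mathrm{dom}\,\phi$ then $\psi(\tau_k,j)=\phi(k,j)$, $\psi(\tau_k,j+1)=\phi(k,j+1)$. *)

(* Defs.v *)
From mathcomp Require Import all_boot all_order all_algebra.
From mathcomp Require Import all_classical all_reals all_analysis.

Set Implicit Arguments.
Unset Strict Implicit.
Unset Printing Implicit Defensive.

Import Order.TTheory GRing.Theory Num.Theory.
Import numFieldNormedType.Exports.

Local Open Scope classical_set_scope.
Local Open Scope ring_scope.

(** The library norm on ['rV[R]_n] is the sup norm.  It is used below only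
    through notions that do not depend on the choice of a norm on R^n (topology,
    boundedness); wherever the size of a vector matters, the Euclidean norm is
    used. *)
Definition enorm {R : realType} {n : nat} (x : 'rV[R]_n) : R :=
  Num.sqrt (\sum_(i < n) x 0 i ^+ 2).

(** x + e B, with B the closed Euclidean unit ball. *)
Definition ecball {R : realType} {n : nat} (x : 'rV[R]_n) (e : R)
    : set 'rV[R]_n :=
  [set y | enorm (y - x) <= e].

(** A + e B. *)
Definition fatten {R : realType} {n : nat} (A : set 'rV[R]_n) (e : R)
    : set 'rV[R]_n :=
  \bigcup_(x in A) ecball x e.

Definition closed_convex_hull {R : realType} {n : nat} (A : set 'rV[R]_n)
    : set 'rV[R]_n :=
  closure (smallest (fun B : set (convex_lmodType 'rV[R]_n) => convex_set B) A).

Definition abs_continuous {R : realType} {n : nat} (f : R -> 'rV[R]_n) (a b : R)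
    : Prop :=
  forall e : R, 0 < e -> exists2 d : R, 0 < d &
    forall (N : nat) (u v : nat -> R),
      (forall i, (i < N)%N -> [/\ a <= u i, u i <= v i & v i <= b]) ->
      trivIset `I_N (fun i => `]u i, v i[%classic) ->
      \sum_(i < N) (v i - u i) < d ->
      \sum_(i < N) enorm (f (v i) - f (u i)) < e.

(** Painleve-Kuratowski convergence of a sequence of sets. *)
Definition set_limsup {X : topologicalType} (S : nat -> set X) : set X :=
  [set x | forall V, nbhs x V ->
     forall N, exists2 i, (N <= i)%N & S i `&` V !=set0].

Definition set_liminf {X : topologicalType} (S : nat -> set X) : set X :=
  [set x | forall V, nbhs x V -> \forall i \near \oo, S i `&` V !=set0].

Definition set_cvg {X : topologicalType} (S : nat -> set X) (L : set X) : Prop :=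
  set_limsup S = L /\ set_liminf S = L.

(** Set-valued maps. *)

Definition sv_image {X Y : Type} (F : X -> set Y) (A : set X) : set Y :=
  \bigcup_(x in A) F x.

Definition sv_dom {X Y : Type} (F : X -> set Y) : set X :=
  [set x | F x !=set0].

Definition sv_graph {X Y : Type} (F : X -> set Y) : set (X * Y) :=
  [set z | F z.1 z.2].

Definition outer_semicontinuous {X Y : topologicalType} (F : X -> set Y)
    : Prop :=
  forall (x : X) (y : Y) (u : nat -> X) (v : nat -> Y),
    (forall i, F (u i) (v i)) ->
    u @ \oo --> x -> v @ \oo --> y -> F x y.

Definition locally_bounded {R : realType} {n : nat}
    (F : 'rV[R]_n -> set 'rV[R]_n) : Prop :=
  forall x : 'rV[R]_n, exists2 U, nbhs x U & bounded_set (sv_image F U).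

Record hybrid_data (R : realType) (n : nat) := HybridData {
  flow_set : set 'rV[R]_n;
  flow_map : 'rV[R]_n -> set 'rV[R]_n;
  jump_set : set 'rV[R]_n;
  jump_map : 'rV[R]_n -> set 'rV[R]_n }.

Definition hybrid_basic_conditions {R : realType} {n : nat}
    (H : hybrid_data R n) : Prop :=
  [/\ closed (flow_set H) /\ closed (jump_set H),
      outer_semicontinuous (flow_map H) /\ locally_bounded (flow_map H),
      outer_semicontinuous (jump_map H) /\ locally_bounded (jump_map H),
      (forall x, flow_set H x -> flow_map H x !=set0 /\
         convex_set (flow_map H x : set (convex_lmodType 'rV[R]_n))) &
      (forall x, jump_set H x -> jump_map H x !=set0)].

(** Outside the inflated flow (jump) set the inflated flow (jump) map is
    empty. *)
Definition inflated {R : realType} {n : nat} (e : R) (H : hybrid_data R n)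
    : hybrid_data R n :=
  {| flow_set := fatten (flow_set H) e;
     flow_map := fun x => fatten (closed_convex_hull
       (sv_image (flow_map H) (ecball x e `&` flow_set H))) e;
     jump_set := fatten (jump_set H) e;
     jump_map := fun x => fatten
       (sv_image (jump_map H) (ecball x e `&` jump_set H)) e |}.

(** Hybrid time domains ([T] the reals) and hybrid sequence domains ([T] the
    natural numbers), with [z] the zero of [T].  Order intervals in [T] are
    real intervals in the first case and integer ranges in the second. *)
Definition compact_hybrid_domain {d : Order.disp_t} {T : porderType d} (z : T)
    (E : set (T * nat)) : Prop :=
  exists (J : nat) (t : nat -> T),
    [/\ (0 < J)%N, t 0%N = z,
        (forall i, (i < J)%N -> (t i <= t i.+1)%O) &
        E = [set p | (p.2 < J)%N /\ (t p.2 <= p.1 <= t p.2.+1)%O]].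

Definition hybrid_domain {d : Order.disp_t} {T : porderType d} (z : T)
    (E : set (T * nat)) : Prop :=
  exists S : nat -> set (T * nat),
    [/\ (forall m, compact_hybrid_domain z (S m)),
        (forall m, S m `<=` S m.+1) &
        E = \bigcup_m S m].

(** A partial function from [T * nat] to R^n, with domain [hdom].  The values of
    [hval] outside [hdom] are irrelevant: they can affect the definitions below
    only through derivatives at end points of intervals, a null set. *)
Record hmap (T : Type) (R : realType) (n : nat) := HMap {
  hdom : set (T * nat);
  hval : T -> nat -> 'rV[R]_n }.

Definition hmap_bounded {T : Type} {R : realType} {n : nat} (a : hmap T R n)
    : Prop :=
  bounded_set [set hval a p.1 p.2 | p in hdom a].

(** A partial function on R x N as a set-valued map on R^2. *)
Definition sv_of_hmap {R : realType} {n : nat} (a : hmap R R n)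
    : R * R -> set 'rV[R]_n :=
  fun p => [set x | exists j : nat,
    [/\ p.2 = j%:R, hdom a (p.1, j) & x = hval a p.1 j]].

Definition hmap_complete {R : realType} {n : nat} (a : hmap R R n) : Prop :=
  ~ bounded_set (sv_dom (sv_of_hmap a)).

Definition hybrid_arc {R : realType} {n : nat} (a : hmap R R n) : Prop :=
  hybrid_domain 0 (hdom a) /\
  forall (t t' : R) (j : nat), hdom a (t, j) -> hdom a (t', j) -> t < t' ->
    abs_continuous (hval a ^~ j) t t'.

Definition solution {R : realType} {n : nat} (H : hybrid_data R n)
    (a : hmap R R n) : Prop :=
  [/\ hybrid_arc a,
      (flow_set H `|` jump_set H) (hval a 0 0%N),
      (forall (t t' : R) (j : nat), t < t' ->
         (forall r, t <= r <= t' -> hdom a (r, j)) ->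
         {ae lebesgue_measure, forall r : R, t <= r <= t' ->
            [/\ flow_set H (hval a r j),
                derivable (hval a ^~ j) r 1 &
                flow_map H (hval a r j) (derive1 (hval a ^~ j) r)]}) &
      (forall (t : R) (j : nat), hdom a (t, j) -> hdom a (t, j.+1) ->
         jump_set H (hval a t j) /\
         jump_map H (hval a t j) (hval a t j.+1))].

Definition sv_tail {R : realType} {n : nat} (xi : R * R -> set 'rV[R]_n)
    (s : R * R) : R * R -> set 'rV[R]_n :=
  fun p => [set x | [/\ 0 <= p.1, 0 <= p.2 & xi (s.1 + p.1, s.2 + p.2) x]].

Definition asymptotic_solution {R : realType} {n : nat} (H : hybrid_data R n)
    (xi : R * R -> set 'rV[R]_n) : Prop :=
  [/\ sv_dom xi `<=` [set p | 0 <= p.1 /\ 0 <= p.2],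
      bounded_set (sv_image xi setT),
      ~ bounded_set (sv_dom xi) &
      forall (p : nat -> R * R) (L : set (R * R * 'rV[R]_n)),
        (forall i, sv_dom xi (p i)) ->
        (p i).1 + (p i).2 @[i --> \oo] --> +oo ->
        set_cvg (fun i => sv_graph (sv_tail xi (p i))) L ->
        exists a : hmap R R n,
          [/\ solution H a, hmap_complete a & L = sv_graph (sv_of_hmap a)]].

(** The domain condition (i) on [chi] is accounted for by evaluating [chi] only
    at the arguments [(s, i, t, j)] that satisfy [chi_dom psi]. *)
Definition chi_dom {R : realType} {n : nat} (psi : hmap R R n)
    (s : R) (i : nat) (t : R) (j : nat) : Prop :=
  [/\ hdom psi (s, i), hdom psi (t, j) & s + i%:R <= t + j%:R].

Definition vanishing_perturbation {R : realType} {n : nat} (psi : hmap R R n)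
    (chi : R -> nat -> R -> nat -> 'rV[R]_n) : Prop :=
  (forall (s : R) (i : nat) (t1 t2 : R) (j : nat),
     chi_dom psi s i t1 j -> chi_dom psi s i t2 j -> t1 < t2 ->
     abs_continuous (fun t => chi s i t j) t1 t2) /\
  (forall tau : R, 0 < tau -> forall e : R, 0 < e -> exists kappa : R,
     forall (s : R) (i : nat), hdom psi (s, i) -> kappa <= s + i%:R ->
     (ereal_sup [set (enorm (chi s i p.1 p.2))%:E | p in
        [set p : R * nat | chi_dom psi s i p.1 p.2 /\
           0 <= p.1 + p.2%:R - (s + i%:R) <= tau]%R] <= e%:E)%E).

Definition perturbed_tail {R : realType} {n : nat} (psi : hmap R R n)
    (chi : R -> nat -> R -> nat -> 'rV[R]_n) (T s : R) (i : nat)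
    : hmap R R n :=
  {| hdom := [set p : R * nat | [/\ 0 <= p.1, hdom psi (s + p.1, (i + p.2)%N) &
                p.1 + p.2%:R <= T]];
     hval := fun t j =>
       hval psi (s + t) (i + j)%N + chi s i (s + t) (i + j)%N |}.

Definition vanishing_inflation_solution {R : realType} {n : nat}
    (H : hybrid_data R n) (psi : hmap R R n) : Prop :=
  [/\ hybrid_arc psi, hmap_complete psi, hmap_bounded psi &
      exists2 chi : R -> nat -> R -> nat -> 'rV[R]_n,
        vanishing_perturbation psi chi &
        forall e T : R, 0 < e -> 0 < T -> exists2 kappa : R, 0 < kappa &
          forall (s : R) (i : nat), hdom psi (s, i) -> kappa <= s + i%:R ->
            solution (inflated e H) (perturbed_tail psi chi T s i)].

(** Minimum and maximum of a set of natural numbers, 0 when there is none. *)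
Definition nat_min (A : set nat) : nat :=
  xget 0%N [set k | A k /\ forall l, A l -> (k <= l)%N].

Definition nat_max (A : set nat) : nat :=
  xget 0%N [set k | A k /\ forall l, A l -> (l <= k)%N].

Definition hybrid_sequence {R : realType} {n : nat} (phi : hmap nat R n)
    : Prop :=
  hybrid_domain 0%N (hdom phi).

Definition complete_seq {R : realType} {n : nat} (phi : hmap nat R n) : Prop :=
  forall N, exists k j, hdom phi (k, j) /\ (N <= k + j)%N.

Definition k_complete {R : realType} {n : nat} (phi : hmap nat R n) : Prop :=
  forall N, exists k j, hdom phi (k, j) /\ (N <= k)%N.

Definition j_complete {R : realType} {n : nat} (phi : hmap nat R n) : Prop :=
  forall N, exists k j, hdom phi (k, j) /\ (N <= j)%N.

(** [jbar] is only used for sequences complete in the k direction and [kbar]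
    for sequences complete in the j direction, so the infima are over nonempty
    sets. *)
Definition jbar {R : realType} {n : nat} (phi : hmap nat R n) (k : nat) : nat :=
  nat_min [set j | hdom phi (k.+1, j)].

Definition kbar {R : realType} {n : nat} (phi : hmap nat R n) (j : nat) : nat :=
  nat_min [set k | hdom phi (k, j.+1)].

(** Step sizes are indexed from 1: [h 0] is never used. *)
Definition tau {R : realType} (h : nat -> R) (k : nat) : R :=
  \sum_(0 <= i < k) h i.+1.

Definition admissible {R : realType} (h : nat -> R) : Prop :=
  [/\ (forall k, (0 < k)%N -> 0 < h k),
      h k @[k --> \oo] --> 0 &
      tau h k @[k --> \oo] --> +oo].

Definition mtime {R : realType} (h : nat -> R) (t : R) : nat :=
  nat_max [set k | tau h k <= t].

(** [fhat phi h k] is the difference quotient of index k + 1. *)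
Definition fhat {R : realType} {n : nat} (phi : hmap nat R n) (h : nat -> R)
    (k : nat) : 'rV[R]_n :=
  (h k.+1)^-1 *: (hval phi k.+1 (jbar phi k) - hval phi k (jbar phi k)).

Definition asymptotic_simulation {R : realType} {n : nat} (H : hybrid_data R n)
    (phi : hmap nat R n) (h : nat -> R) : Prop :=
  [/\ admissible h,
      hybrid_sequence phi /\ hmap_bounded phi /\ complete_seq phi,
      (k_complete phi -> exists f : nat -> 'rV[R]_n,
         [/\ bounded_set (range f),
             cluster ((hval phi k (jbar phi k), f k) @[k --> \oo])
               `<=` sv_graph (flow_map H) `&` (flow_set H `*` setT) &
             exists2 T : R, 0 < T &
               sup [set enorm (\sum_(k <= i < l)
                        h i.+1 *: (fhat phi h i - f i)) | l in
                      [set l | (k.+1 <= l <= mtime h (tau h k + T))%N]]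
                 @[k --> \oo] --> 0]) &
      (j_complete phi ->
         cluster ((hval phi (kbar phi j) j, hval phi (kbar phi j) j.+1)
                    @[j --> \oo])
           `<=` sv_graph (jump_map H) `&` (jump_set H `*` setT))].

(** [xget] picks the unique element: [tau h] is injective for admissible [h]. *)
Definition compressed {R : realType} {n : nat} (phi : hmap nat R n)
    (h : nat -> R) : hmap R R n :=
  {| hdom := [set p | exists2 k, hdom phi (k, p.2) & p.1 = tau h k];
     hval := fun t j => xget 0 [set x | exists k,
       [/\ hdom phi (k, j), t = tau h k & x = hval phi k j]] |}.

(** The three clauses agree where they overlap, and one of them applies at every
    point of the domain when [phi] is a complete hybrid sequence and [h] is
    admissible. *)
Definition interpolated {R : realType} {n : nat} (phi : hmap nat R n)
    (h : nat -> R) : hmap R R n :=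
  {| hdom := [set p | exists t t' : R,
       [/\ hdom (compressed phi h) (t, p.2),
           hdom (compressed phi h) (t', p.2) & t <= p.1 <= t']];
     hval := fun t j => xget 0 [set x |
       [\/ exists k, [/\ hdom phi (k, j), hdom phi (k.+1, j),
             tau h k <= t <= tau h k.+1 &
             x = hval phi k j + ((t - tau h k) / h k.+1) *:
                   (hval phi k.+1 j - hval phi k j)],
           exists k, [/\ hdom phi (k, j), hdom phi (k, j.+1), t = tau h k &
             x = hval phi k j] |
           exists k i, [/\ j = i.+1, hdom phi (k, i), hdom phi (k, i.+1),
             t = tau h k & x = hval phi k i.+1]]] |}.

(* Main.v *)
Require Import Defs.
From HB Require Import structures.
From mathcomp Require Import all_boot all_order all_algebra.
From mathcomp Require Import all_classical all_reals all_analysis.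
From mathcomp Require Import ring lra zify.

(** The domain of a complete hybrid sequence is a lattice path: its points can be
    listed as [(K m, J m)], each step raising one coordinate by one
    ([hybrid_domain_path]).  A step in [k] is a flow step of length [h (K m).+1], a
    step in [j] is a jump.  On each slice the interpolated mapping differs by a
    constant from the integral of the difference quotients [fhat], a function of
    time only ([interpolatedE]).  Write [fhat = f + (fhat - f)], where [f] is the
    sequence supplied by the simulation.  By compactness, late pairs (state, [f]) at
    flow steps are close to the graph of the flow map over the flow set, and late
    jumps are close to the graph of the jump map over the jump set
    ([cluster_near]).  The integral of the noise [fhat - f] is small over windows of
    some length [T0], hence over windows of any length ([noise_small]).  All
    conclusions of the theorem rest on these facts, collected in [simulation_tracks].

    Vanishing inflation: the perturbation [chi] is minus the noise integrated from
    the start of the tail.  It tends to zero on bounded windows, and the perturbed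
    arc has velocity [f] on each flow step, so that the inclusions of the inflated
    system hold outside the corners of the interpolation
    ([perturbed_tail_solution]).

    Asymptotic solutions: let tails of the interpolated mapping converge graphically
    to a set [Lim].  The increments of a late tail are bounded by a fixed multiple
    of the elapsed time, up to a small error, so [Lim] is the graph of a function
    that is Lipschitz on each slice ([lim_lipschitz]), and its slices inherit from
    the tails the structure of a hybrid time domain ([lim_arc_domain]).  Points of the
    limit come from compactness ([lim_sup]), and they attract all nearby points of
    late tails ([lim_val]).  Over a short interval on which the limit stays close to
    [x0], the average velocity of a late tail is close to the values of the flow map
    at [x0], because averages stay in convex sets ([step_integral_mean]) and the
    flow map is upper semicontinuous ([osc_usc]).  This passes to the limit ([lim_arc_slope]) and gives the
    differential inclusion wherever the limit is differentiable.  Lipschitz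
    functions are differentiable almost everywhere ([lipschitz_ae_derivable], by
    the Radon-Nikodym theorem and Lebesgue's differentiation theorem).

    The compressed-domain version is the restriction of the interpolated mapping to
    the corner times, whose spacing tends to zero, as does the motion between them; the
    tails of both have the same graphical limits ([compressed_limsup]). *)

Set Implicit Arguments.
Unset Strict Implicit.
Unset Printing Implicit Defensive.

Import Order.TTheory GRing.Theory Num.Theory.
Import numFieldNormedType.Exports.

Local Open Scope classical_set_scope.
Local Open Scope ring_scope.

(** * Norms, compactness and semicontinuity *)

Section Norms.
Context {R : realType} {n : nat}.
Implicit Types (x y z : 'rV[R]_n).

Lemma enorm_le_norm x : enorm x <= n%:R * `|x|.
Proof.
have xi i : `|x 0 i| <= `|x|.
  rewrite [leRHS]/Num.Def.normr/= mx_normrE.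
  exact: (le_bigmax _ (fun i : 'I_1 * 'I_n => `|x i.1 i.2|) (0, i)).
rewrite /enorm -[leRHS]ger0_norm ?mulr_ge0// -sqrtr_sqr ler_wsqrtr//.
rewrite exprMn; apply: (@le_trans _ _ (\sum_(i < n) `|x| ^+ 2)).
  by apply: ler_sum => i _; rewrite -[leLHS]real_normK ?num_real// lerXn2r ?nnegrE.
rewrite sumr_const card_ord -[leLHS]mulr_natl ler_wpM2r ?sqr_ge0//.
rewrite expr2 -natrM ler_nat; case: (n) => // k; exact: leq_pmulr.
Qed.

Lemma norm_le_enorm x : `|x| <= enorm x.
Proof.
rewrite [leLHS]/Num.Def.normr/= mx_normrE; apply: bigmax_le; first exact: sqrtr_ge0.
move=> [i j] _ /=; rewrite (ord1 i) -sqrtr_sqr ler_wsqrtr//.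
by rewrite (bigD1 j)//= lerDl sumr_ge0// => k _; rewrite sqr_ge0.
Qed.

(** The factor [n.+1], unlike [n], can be divided by in dimension 0 as well. *)
Lemma enorm_le x (e : R) : n.+1%:R * `|x| <= e -> enorm x <= e.
Proof.
move=> H; apply: le_trans H; apply: le_trans (enorm_le_norm x) _.
by rewrite ler_wpM2r// ler_nat.
Qed.

Lemma enorm_le_scaled x (e : R) : `|x| <= e / n.+1%:R -> enorm x <= e.
Proof. by move=> xe; apply: enorm_le; rewrite mulrC -ler_pdivlMr. Qed.

End Norms.

(** Sequential compactness in the form used below: the indices [g N] are late, but
    nothing is gained from making them increase. *)
Lemma compact_subseq {R : realType} {V : normedModType R} (A : set V)
    (u : nat -> V) :
  compact A -> (forall N, A (u N)) ->
  exists (l : V) (g : nat -> nat),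
    forall N, (N <= g N)%N /\ `|u (g N) - l| < N.+1%:R^-1.
Proof.
move=> cA Au; have [|l [Al cl]] := cA (u @ \oo) _.
  by exists 0%N => // k _ /=; exact: Au.
have H N : exists k, (N <= k)%N /\ `|u k - l| < N.+1%:R^-1.
  have [] := cl [set u k | k in [set k | (N <= k)%N]] (ball l N.+1%:R^-1).
  - by exists N => // k Nk /=; exists k.
  - by apply: nbhsx_ballx; rewrite invr_gt0.
  - by move=> _ [[k Nk <-]]; rewrite -ball_normE /ball_/= distrC => ?; exists k.
by exists l, (fun N => sval (cid (H N))) => N; case: cid.
Qed.

Lemma norm_bounded_compact {R : realType} {n : nat} (M : R) :
  compact [set x : 'rV[R]_n | `|x| <= M].
Proof.
apply: bounded_closed_compact.
  by exists M; split; [exact: num_real|move=> N MN x /= xM; exact: le_trans (ltW MN)].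
apply: (@closed_comp _ _ (fun x : 'rV[R]_n => `|x|) [set y | y <= M]).
  by move=> x _; exact: norm_continuous.
exact: closed_le.
Qed.

Lemma bounded_setPle {R : realType} {V : normedModType R} (A : set V) :
  bounded_set A <-> exists2 M : R, 0 < M & forall x, A x -> `|x| <= M.
Proof.
split=> [[M [_ HM]]|[M M0 HM]].
  exists (`|M| + 1); first by rewrite ltr_wpDl.
  by move=> x; apply: HM; rewrite ltr_pwDr// ler_norm.
by exists M; split; [exact: num_real|move=> N MN x /HM xM; exact: le_trans (ltW MN)].
Qed.

Lemma le_of_le_small_mul {R : realType} (a b c : R) : 0 < c ->
  (forall e : R, 0 < e -> e <= 1 -> a <= b + c * e) -> a <= b.
Proof.
move=> c0 Hab; apply/ler_addgt0Pr => e e0.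
have m0 : 0 < Num.min 1 (e / c) by rewrite lt_min ltr01 divr_gt0.
apply: le_trans (Hab _ m0 _) _; first by rewrite ge_min lexx.
by rewrite lerD2l mulrC -ler_pdivlMr// ge_min lexx orbT.
Qed.

Lemma invS_small {R : realType} (e : R) : 0 < e ->
  exists N, forall k, (N <= k)%N -> k.+1%:R^-1 < e.
Proof.
move=> e0; have [N _ HN] := near_infty_natSinv_lt (PosNum e0).
by exists N => k Nk; exact: HN.
Qed.

(** Outer semicontinuity without sequences: approximations of a point by points of
    the graph, chosen at the scales 1, 1/2, 1/3 and so on, form the sequences of its
    definition. *)
Lemma osc_closed {R : realType} {n : nat} (F : 'rV[R]_n -> set 'rV[R]_n) a b :
  outer_semicontinuous F ->
  (forall e : R, 0 < e -> exists x y, [/\ F x y, `|x - a| < e & `|y - b| < e]) ->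
  F a b.
Proof.
move=> oF H.
have H' N : exists z : 'rV[R]_n * 'rV[R]_n,
    [/\ F z.1 z.2, `|z.1 - a| < N.+1%:R^-1 & `|z.2 - b| < N.+1%:R^-1].
  by have [|x [y [? ? ?]]] := H N.+1%:R^-1; [rewrite invr_gt0|exists (x, y)].
pose z N := sval (cid (H' N)).
have zP N : [/\ F (z N).1 (z N).2, `|(z N).1 - a| < N.+1%:R^-1
    & `|(z N).2 - b| < N.+1%:R^-1] by rewrite /z; case: cid.
apply: (oF a b (fun N => (z N).1) (fun N => (z N).2)).
- by move=> N; have [] := zP N.
- apply/cvgrPdist_lt => e /invS_small[N HN]; exists N => // k Nk /=.
  by have [_ + _] := zP k; rewrite distrC => /lt_trans; apply; exact: HN.
- apply/cvgrPdist_lt => e /invS_small[N HN]; exists N => // k Nk /=.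
  by have [_ _ +] := zP k; rewrite distrC => /lt_trans; apply; exact: HN.
Qed.

Lemma closed_approx {R : realType} {V : normedModType R} (A : set V) a :
  closed A -> (forall e : R, 0 < e -> exists2 x, A x & `|x - a| < e) -> A a.
Proof.
move=> cA H; apply: cA => B /nbhs_ballP[e /= e0 HB].
have [x Ax xa] := H e e0; exists x; split => //; apply: HB.
by rewrite -ball_normE /ball_/= distrC.
Qed.

(** Closed graph and local boundedness give upper semicontinuity: otherwise
    values far from [F x0] at points tending to [x0] would have a limit point,
    and that limit point belongs to [F x0]. *)
Lemma osc_usc {R : realType} {n : nat} (F : 'rV[R]_n -> set 'rV[R]_n) x0 (eta : R) :
  outer_semicontinuous F -> locally_bounded F -> 0 < eta ->
  exists2 rho : R, 0 < rho & forall x y, `|x - x0| < rho -> F x y ->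
    exists2 z, F x0 z & `|y - z| <= eta.
Proof.
move=> oF lF eta0; apply: contrapT => Hn.
have H N : exists z : 'rV[R]_n * 'rV[R]_n, [/\ `|z.1 - x0| < N.+1%:R^-1,
    F z.1 z.2 & forall w, F x0 w -> eta < `|z.2 - w|].
  apply: contrapT => Hz; apply: Hn; exists N.+1%:R^-1; first by rewrite invr_gt0.
  move=> x y xx0 Fxy; apply: contrapT => Hw; apply: Hz; exists (x, y); split => //.
  by move=> w Fw; rewrite ltNge; apply/negP => yw; apply: Hw; exists w.
pose z N := sval (cid (H N)).
have zP N : [/\ `|(z N).1 - x0| < N.+1%:R^-1, F (z N).1 (z N).2 &
    forall w, F x0 w -> eta < `|(z N).2 - w|] by rewrite /z; case: cid.
have [U /nbhs_ballP[r /= r0 rU] /bounded_setPle[M M0 HM]] := lF x0.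
have [N0 HN0] := invS_small r0.
pose y k := (z (k + N0)%N).2.
have yM k : [set w | `|w| <= M] (y k).
  rewrite /y /=; have [zx Fz _] := zP (k + N0)%N; apply: HM.
  exists (z (k + N0)%N).1 => //; apply: rU; rewrite -ball_normE /ball_/= distrC.
  by apply: lt_trans zx _; apply: HN0; rewrite leq_addl.
have [l [g lg]] := compact_subseq (norm_bounded_compact (M:=M)) yM.
have Fl : F x0 l.
  apply: osc_closed oF _ => e /invS_small[N1 HN1].
  exists (z (g N1 + N0)%N).1, (z (g N1 + N0)%N).2.
  have [gN yl] := lg N1; have [zx Fz _] := zP (g N1 + N0)%N; split => //.
    by apply: lt_trans zx _; apply: HN1; apply: leq_trans gN _; rewrite leq_addr.
  by apply: lt_trans yl _; exact: HN1.
have [N1 HN1] := invS_small eta0; have [_ yl] := lg N1.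
have [_ _ /(_ l Fl)] := zP (g N1 + N0)%N; apply/negP; rewrite -leNgt ltW//.
by apply: lt_trans yl _; exact: HN1.
Qed.

Lemma lipschitz_abs_continuous {R : realType} {n : nat} (f : R -> 'rV[R]_n)
    (a b M : R) :
  (forall u v, a <= u -> u <= v -> v <= b -> `|f v - f u| <= M * (v - u)) ->
  abs_continuous f a b.
Proof.
move=> Hf e e0; pose c := n.+1%:R * (`|M| + 1).
have c0 : 0 < c by rewrite mulr_gt0// ltr_wpDl.
exists (e / c); first by rewrite divr_gt0.
move=> N u v Huv _ Hs.
apply: (@le_lt_trans _ _ (\sum_(i < N) c * (v i - u i))).
  apply: ler_sum => i _; have [au uv vb] := Huv i (ltn_ord i).
  apply: enorm_le; rewrite /c -mulrA ler_wpM2l//.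
  apply: le_trans (Hf _ _ au uv vb) _; rewrite ler_wpM2r ?subr_ge0//.
  by rewrite (le_trans (ler_norm _))// lerDl.
by rewrite -mulr_sumr -ltr_pdivlMl// mulrC.
Qed.

(** * Hybrid time domains as chains of intervals *)

Definition slices_convex {R : realType} (E : set (R * nat)) : Prop :=
  forall t s r j, E (t, j) -> E (s, j) -> t <= r -> r <= s -> E (r, j).

(** The point [c] is the time of the jump from [j] to [j.+1]. *)
Definition slices_abut {R : realType} (E : set (R * nat)) : Prop :=
  forall t j, E (t, j.+1) -> exists c, [/\ E (c, j), E (c, j.+1),
    forall s, E (s, j) -> s <= c & forall s, E (s, j.+1) -> c <= s].

Lemma slice_down {R : realType} (E : set (R * nat)) t k j :
  slices_abut E -> E (t, k) -> (j <= k)%N -> exists2 u, u <= t & E (u, j).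
Proof.
move=> abut; elim: k t => [|k IH] t dt; first by rewrite leqn0 => /eqP->; exists t.
rewrite leq_eqVlt => /predU1P[->|]; first by exists t.
have [c [dc _ _ ct]] := abut _ _ dt; rewrite ltnS => jk.
by have [u uc du] := IH _ dc jk; exists u => //; apply: le_trans uc (ct _ dt).
Qed.

(** Every slice but the last ends at the next jump time and is compact.  The last
    one, when there is one, may not be; the sequence [b] exhausts it. *)
Lemma hybrid_domain_slices {R : realType} (E : set (R * nat)) :
  E (0, 0%N) ->
  (forall t, E (t, 0%N) -> 0 <= t) ->
  slices_convex E ->
  slices_abut E ->
  (forall t j, E (t, j) -> (forall s, ~ E (s, j.+1)) ->
     exists b : nat -> R, [/\ forall m, E (b m, j), forall m, b m <= b m.+1 &
       forall s, E (s, j) -> exists m, s <= b m]) ->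
  hybrid_domain (0 : R) E.
Proof.
move=> E00 E0 Econv Echain Elast.
(* [c j] is the start of slice [j], the jump time when [j] is positive. *)
pose Q j c := E (c, j) /\ forall s, E (s, j) -> c <= s.
have Qex j : exists c, (exists t, E (t, j)) -> Q j c.
  have [[t Et]|nE] := pselect (exists t, E (t, j)); last by exists 0.
  case: j t Et => [|j] t Et; first by exists 0 => _; split.
  by have [c [_ ? _ ?]] := Echain _ _ Et; exists c.
pose c j := sval (cid (Qex j)).
have cP j : (exists t, E (t, j)) -> Q j (c j) by rewrite /c; case: cid.
have c0 : c 0%N = 0.
  have [Ec cle] := cP 0%N (ex_intro _ _ E00).
  by apply/eqP; rewrite eq_le cle//= E0.
have cS j : (exists t, E (t, j.+1)) ->
    E (c j.+1, j) /\ forall s, E (s, j) -> s <= c j.+1.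
  move=> He; have [t Et] := He; have [Ec cle] := cP _ He.
  have [d [Ed Ed' dle dge]] := Echain _ _ Et.
  suff -> : c j.+1 = d by [].
  by apply/eqP; rewrite eq_le cle//= dge.
have cmono j : (exists t, E (t, j.+1)) -> c j <= c j.+1.
  by move=> He; have [Ec _] := cS _ He; have [_] := cP j (ex_intro _ _ Ec); exact.
have [Hall|] := pselect (forall j, exists t, E (t, j)).
  exists (fun m => [set p : R * nat | (p.2 < m.+1)%N /\ (c p.2 <= p.1 <= c p.2.+1)]).
  split.
  - by move=> m; exists m.+1, c; split=> // i _; exact: cmono.
  - by move=> m [t j] /= [jm H]; split => //; rewrite (leq_trans jm).
  - apply/seteqP; split=> [[t j] Etj|[t j] [m _ /= [_ /andP[ct tc]]]].
      exists j => //; split => //=.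
      by rewrite (cP j (Hall j)).2//= (cS j (Hall j.+1)).2.
    by apply: Econv (cP j (Hall j)).1 (cS j (Hall j.+1)).1 ct tc.
move=> /existsNP[j1 Hj1].
have [J [[t0 EJ] EJS]] : exists J, (exists t, E (t, J)) /\ forall s, ~ E (s, J.+1).
  apply: contrapT => Hn; apply: Hj1; elim: j1 => [|j IH]; first by exists 0.
  apply: contrapT => Hj; apply: Hn; exists j; split => // s Es; apply: Hj.
  by exists s.
have Hle t j : E (t, j) -> (j <= J)%N.
  move=> Etj; rewrite leqNgt; apply/negP => Jj.
  by have [s _ /EJS] := slice_down Echain Etj Jj.
have Hex j : (j <= J)%N -> exists t, E (t, j).
  by move=> jJ; have [s _ Es] := slice_down Echain EJ jJ; exists s.
have [b [bE bmono bcof]] := Elast _ _ EJ EJS.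
(* Slice [J] is the last one: keep the jump times and cut it off at [b m]. *)
pose d m i := if (i <= J)%N then c i else b m.
have dle m i : (i < J.+1)%N -> d m i <= d m i.+1.
  rewrite ltnS => iJ; rewrite /d iJ; case: ltnP => [iJ'|Ji].
    by apply: cmono; apply: Hex.
  have <- : J = i by apply/eqP; rewrite eqn_leq Ji iJ.
  by have [_] := cP J (Hex J (leqnn _)); exact.
exists (fun m => [set p : R * nat | (p.2 < J.+1)%N /\ (d m p.2 <= p.1 <= d m p.2.+1)]).
split.
- by move=> m; exists J.+1, (d m); split=> //; exact: dle.
- move=> m [t j] /= [jJ /andP[H1 H2]]; split => //.
  move: H1 H2; rewrite /d; rewrite ltnS in jJ; rewrite jJ => ->/=.
  by case: ifP => // _ /le_trans; apply.
- apply/seteqP; split=> [[t j] Etj|[t j] [m _ /= [jJ]]].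
    have jJ := Hle _ _ Etj; have [_ cj] := cP j (Hex j jJ).
    move: (jJ); rewrite leq_eqVlt => /predU1P[jE|jJ'].
      subst j; have [m tm] := bcof _ Etj; exists m => //; split => //=.
      by rewrite /d leqnn ltnn cj.
    exists 0%N => //; split => //=; rewrite /d jJ jJ' cj//=.
    by apply: (cS j (Hex _ jJ')).2.
  rewrite /d; rewrite ltnS in jJ; rewrite jJ => /andP[H1].
  have [Ecj _] := cP j (Hex j jJ); case: ltnP => [jJ'|Jj] H2.
    by apply: Econv Ecj (cS j (Hex _ jJ')).1 H1 H2.
  have jE : J = j by apply/eqP; rewrite eqn_leq Jj jJ.
  by subst j; apply: Econv Ecj (bE m) H1 H2.
Qed.

(** * Almost everywhere differentiability of Lipschitz functions *)

(** A real Lipschitz function [f] is almost everywhere differentiable.  The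
    function [f x + M x] is nondecreasing, and the Stieltjes measure it defines is
    at most a multiple of Lebesgue measure on half-open intervals, hence vanishes
    on Lebesgue null sets.  Its Radon-Nikodym density is the derivative at every
    Lebesgue point. *)
Lemma lipschitz_ae_derivable {R : realType} (f : R -> R) (M a b : R) :
  (forall x y, x <= y -> `|f y - f x| <= M * (y - x)) -> a < b ->
  {ae lebesgue_measure, forall x : R, a < x < b -> derivable f x 1}.
Proof.
move=> Hf ab.
have M0 : 0 <= M.
  have := Hf a b (ltW ab); move/(le_trans (normr_ge0 _)).
  by rewrite pmulr_lge0// subr_gt0.
have {M0 Hf} [{}M M0 Hf] : exists2 M : R, 0 < M &
    forall x y, x <= y -> `|f y - f x| <= M * (y - x).
  exists (M + 1) => [|x y xy]; first by rewrite ltr_wpDl.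
  by apply: le_trans (Hf _ _ xy) _; rewrite ler_wpM2r ?subr_ge0// lerDl.
have M2 : 0 < 2 * M by rewrite mulr_gt0.
pose g x := f x + M * x.
have gd x y : x <= y -> 0 <= g y - g x <= 2 * M * (y - x).
  move=> /Hf; rewrite ler_norml => /andP[H1 H2].
  rewrite /g; apply/andP; split; lra.
have gnd : {homo g : x y / x <= y}.
  by move=> x y /gd /andP[+ _]; rewrite subr_ge0.
have grc : forall x, g @ at_right x --> g x.
  apply: right_continuousW => x; apply/cvgrPdist_le => e e0.
  near=> y.
  have yx : `|x - y| <= e / (2 * M + 1).
    by near: y; apply: cvgr_dist_le; [exact: cvg_id|rewrite divr_gt0// ltr_wpDl// ltW].
  apply: (@le_trans _ _ ((2 * M + 1) * `|x - y|)); last first.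
    by rewrite mulrC -ler_pdivlMr// ltr_wpDl// ltW.
  case: (leP x y) => [xy|/ltW xy].
    rewrite distrC [in leRHS]distrC (ger0_norm (_ : 0 <= y - x)) ?subr_ge0//.
    have /andP[H1 H2] := gd _ _ xy; rewrite ger0_norm//; apply: le_trans H2 _.
    by rewrite ler_wpM2r ?subr_ge0// lerDl.
  rewrite (ger0_norm (_ : 0 <= x - y)) ?subr_ge0//.
  have /andP[H1 H2] := gd _ _ xy; rewrite ger0_norm//; apply: le_trans H2 _.
  by rewrite ler_wpM2r ?subr_ge0// lerDl.
pose gc := isCumulative.Build R _ R g gnd grc.
pose G : cumulative R R := HB.pack g gc.
pose nu := lebesgue_stieltjes_measure G.
have nuE x y : x <= y -> nu `]x, y]%classic = (g y - g x)%:E.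
  move=> xy; rewrite /nu /lebesgue_stieltjes_measure /measure_extension.
  by rewrite measurable_mu_extE/=; [rewrite wlength_itv_bnd|exact: is_ocitv].
(* Compare the two outer measures on each cover by half-open intervals. *)
have nu_le (A : set R) : (nu A <= (2 * M)%:E * @lebesgue_measure R A)%E.
  rewrite -lee_pdivrMl//; apply: le_ereal_inf_tmp => _ [F [mF AF] <-].
  rewrite lee_pdivrMl// -nneseriesZl; last by move=> i _; exact: measure_ge0.
  apply: (@le_trans _ _ (\sum_(k <oo) wlength G (F k))%E).
    by apply: ereal_inf_lbound; exists F.
  apply: lee_nneseries => [i _ _|i _]; first exact: measure_ge0.
  have /ocitvP [->|[[x y] /= xy ->]] := mF i.
    by rewrite wlength0; apply: mule_ge0; [rewrite lee_fin ltW|exact: wlength_ge0].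
  rewrite !wlength_itv_bnd ?(ltW xy)// -EFinM lee_fin.
  by have /andP[] := gd _ _ (ltW xy).
(* The Radon-Nikodym theorem asks for a finite measure: restrict to a bounded
   interval. *)
pose D : set (measurableTypeR R) := `]a, b]%classic.
have mD : measurable D by exact: measurable_itv.
have nuD : (nu D < +oo)%E by rewrite nuE ?ltW// ltry.
pose nuf : {finite_measure set (measurableTypeR R) -> \bar R} := mfrestr mD nuD.
have dom : nuf `<< @lebesgue_measure R.
  apply/null_content_dominatesP => A mA A0.
  apply/eqP; rewrite eq_le measure_ge0 andbT.
  apply: (@le_trans _ _ (nu A)).
    by apply: le_measure; rewrite ?inE//; exact: measurableI.
  by apply: le_trans (nu_le A) _; rewrite A0 mule0.
have [rn [rn0 rnfin rnint rnE]] := radon_nikodym_sigma_finite dom.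
pose d x := fine (rn x).
have dE : EFin \o d = rn by apply/funext => x /=; rewrite fineK.
have dint : lebesgue_measure.-integrable setT (EFin \o d) by rewrite dE.
have {}dint : (@lebesgue_measure R).-integrable [set: R] (EFin \o d) by exact: dint.
have dy y : (@lebesgue_measure R).-integrable [set` Interval (BRight a) (BRight y)]
    (EFin \o d) by apply: integrableS dint.
have locd : locally_integrable [set: R] d.
  by apply: open_integrable_locally dint; exact: openT.
have := @FTC1 R d (BRight a) dy locd.
apply: filterS; first exact: (ae_filter_ringOfSetsType lebesgue_measure).
move=> x H /andP[ax xb].
have [|HF _] := H; first by rewrite /= lte_fin.
have HG : derivable (fun y => g y - g a) x 1.
  apply: near_eq_derivable HF; near=> y.
  have ay : a < y by near: y; exact: lt_nbhsr.
  have yb : y < b by near: y; exact: lt_nbhsl.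
  rewrite /Rintegral -[g y - g a]/(fine (g y - g a)%:E); congr fine.
  rewrite -nuE ?(ltW ay)//.
  transitivity (nuf `]a, y]%classic).
    by rewrite rnE; [rewrite -dE|exact: measurable_itv].
  rewrite /nuf /= /mfrestr /mrestr /= setIidl// => z /=.
  by rewrite /D /= !in_itv/= => /andP[-> /= /le_trans]; apply; exact: ltW.
have -> : f = (fun y => (g y - g a) - (M * y - g a)).
  by apply/funext => y; rewrite /g; ring.
by apply: derivableB => //; apply: derivableB => //; apply: derivableM.
Unshelve. all: by end_near. Qed.

Lemma clamp_lipschitz {R : realFieldType} (a b x y : R) : a <= b -> x <= y ->
  [/\ a <= Num.max a (Num.min b x), Num.max a (Num.min b x) <= Num.max a (Num.min b y),
      Num.max a (Num.min b y) <= b &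
      Num.max a (Num.min b y) - Num.max a (Num.min b x) <= y - x].
Proof.
move=> ab xy.
have mE z : (Num.min b z = b /\ b <= z) \/ (Num.min b z = z /\ z < b).
  by case: (leP b z); [left|right].
have ME z : (Num.max a z = z /\ a <= z) \/ (Num.max a z = a /\ z < a).
  by case: (leP a z); [left|right].
have [[-> ?]|[-> ?]] := mE x; have [[-> ?]|[-> ?]] := mE y;
  have [[Eb ?]|[Eb ?]] := ME b; have [[Ex ?]|[Ex ?]] := ME x;
  have [[Ey ?]|[Ey ?]] := ME y; rewrite ?Eb ?Ex ?Ey; by split; lra.
Qed.

Lemma lipschitz_on_ae_derivable {R : realType} {n : nat} (f : R -> 'rV[R]_n)
    (M a b : R) :
  (forall x y, a <= x -> x <= y -> y <= b -> `|f y - f x| <= M * (y - x)) -> a < b ->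
  {ae lebesgue_measure, forall x : R, a < x < b -> derivable f x 1}.
Proof.
move=> Hf ab.
have M0 : 0 <= M.
  have := Hf a b (lexx _) (ltW ab) (lexx _); move/(le_trans (normr_ge0 _)).
  by rewrite pmulr_lge0// subr_gt0.
(* Clamping extends [f] from [a, b] to a Lipschitz function on the line. *)
pose c x := Num.max a (Num.min b x).
have H i : {ae lebesgue_measure, forall x : R, a < x < b ->
    derivable (fun y => f (c y) 0 i) x 1}.
  apply: (@lipschitz_ae_derivable _ _ M) => // x y xy.
  have [ax cxy cb cle] := clamp_lipschitz (ltW ab) xy.
  apply: (@le_trans _ _ (M * (c y - c x))); last by rewrite ler_wpM2l.
  apply: le_trans (Hf _ _ ax cxy cb).
  rewrite [leRHS]/Num.Def.normr/= mx_normrE.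
  have := le_bigmax 0 (fun k : 'I_1 * 'I_n => `|(f (c y) - f (c x)) k.1 k.2|) (0, i).
  by rewrite !mxE.
have {}H : {ae lebesgue_measure, forall x : R, forall i, a < x < b ->
    derivable (fun y => f (c y) 0 i) x 1}.
  have aeF := ae_filter_ringOfSetsType (@lebesgue_measure R).
  exact: (@filter_forall R 'I_n _ (almost_everywhere (@lebesgue_measure R)) aeF H).
move: H; apply: filterS; first exact: (ae_filter_ringOfSetsType lebesgue_measure).
move=> x H axb; apply/derivable_mxP => i j; rewrite (ord1 i).
apply: near_eq_derivable (H j axb); move/andP: axb => [ax xb]; near=> y.
have ay : a < y by near: y; exact: lt_nbhsr.
have yb : y < b by near: y; exact: lt_nbhsl.
suff -> : c y = y by [].
by rewrite /c (min_idPr _) ?ltW// (max_idPr _)// ltW.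
Unshelve. all: by end_near. Qed.

(** * Hybrid sequence domains as lattice paths *)

(** The domain of a complete hybrid sequence is the range of such a path, listed in
    order.  Flow steps and jumps then become the two kinds of steps of one
    sequence, indexed by [m = K m + J m]. *)
Definition lattice_path (K J : nat -> nat) : Prop :=
  [/\ K 0%N = 0%N, J 0%N = 0%N &
      forall m, (K m.+1 = (K m).+1 /\ J m.+1 = J m) \/
                (K m.+1 = K m /\ J m.+1 = (J m).+1)].

Section LatticePath.
Variables (K J : nat -> nat).
Hypothesis HP : lattice_path K J.

Lemma path_sum m : (K m + J m)%N = m.
Proof.
case: HP => K0 J0 HS; elim: m => [|m IH]; first by rewrite K0 J0.
by have [[-> ->]|[-> ->]] := HS m; rewrite ?addSn ?addnS IH.
Qed.

Lemma path_leK m m' : (m <= m')%N -> (K m <= K m')%N.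
Proof.
case: HP => _ _ HS; move: m m'; apply: (homo_leq leqnn leq_trans) => i.
by have [[-> _]|[-> _]] := HS i.
Qed.

Lemma path_leJ m m' : (m <= m')%N -> (J m <= J m')%N.
Proof.
case: HP => _ _ HS; move: m m'; apply: (homo_leq leqnn leq_trans) => i.
by have [[_ ->]|[_ ->]] := HS i.
Qed.

Lemma path_constJ m i m' : (m <= i)%N -> (i <= m')%N -> J m = J m' -> J i = J m.
Proof.
move=> mi im jj; apply/eqP; rewrite eqn_leq (path_leJ mi) andbT jj.
exact: path_leJ.
Qed.

End LatticePath.

(** In a hybrid sequence domain any two points are comparable, so there is at
    most one point of each level [k + j]; completeness supplies one for every
    level. *)
Lemma hybrid_domain_path (E : set (nat * nat)) :
  hybrid_domain 0%N E -> (forall N, exists k j, E (k, j) /\ (N <= k + j)%N) ->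
  exists K J, lattice_path K J /\ forall k j, E (k, j) <-> exists m, K m = k /\ J m = j.
Proof.
move=> [S [HS Smono ES]] Hc.
have Sle m m' : (m <= m')%N -> S m `<=` S m'.
  move: m m'; apply: (homo_leq (r := fun A B : set (nat * nat) => A `<=` B)).
  - by move=> A x.
  - by move=> B A C AB BC x /AB/BC.
  - exact: Smono.
have E2 p q : E p -> E q -> exists2 m, S m p & S m q.
  rewrite ES => -[m _ Sp] [m' _ Sq]; exists (maxn m m').
    exact: Sle (leq_maxl _ _) _ Sp.
  exact: Sle (leq_maxr _ _) _ Sq.
have E00 : E (0%N, 0%N).
  rewrite ES; exists 0%N => //; have [N [t [N0 t0 tm ->]]] := HS 0%N.
  by split => //=; have := tm 0%N N0; rewrite t0.
have Ecmp k j k' j' : E (k, j) -> E (k', j') -> (j < j')%N -> (k <= k')%N.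
  move=> E1 E1'; have [m] := E2 _ _ E1 E1'.
  have [N [t [N0 t0 tm ->]]] := HS m => -[/= jN /andP[_ kt]] [/= jN' /andP[kt' _]] jj.
  apply: leq_trans kt _; apply: leq_trans kt'.
  have : forall d, (j.+1 + d < N)%N -> (t j.+1 <= t (j.+1 + d)%N)%N.
    elim=> [|d IH]; first by rewrite addn0.
    rewrite addnS => dN; apply: leq_trans (IH (ltnW dN)) _.
    by apply: tm; exact: ltnW.
  by move=> /(_ (j' - j.+1)%N); rewrite subnKC//; exact.
have Euniq k j k' j' : E (k, j) -> E (k', j') -> (k + j = k' + j')%N -> k = k' /\ j = j'.
  move=> E1 E1' ee; case: (ltngtP j j') => [jj|jj|jj].
  - by have := Ecmp _ _ _ _ E1 E1' jj; lia.
  - by have := Ecmp _ _ _ _ E1' E1 jj; lia.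
  - by split => //; lia.
have Enext k j : E (k, j) -> E (k.+1, j) \/ E (k, j.+1).
  move=> E1; have [k' [j' [E1' ll]]] := Hc (k + j).+1.
  have [m] := E2 _ _ E1 E1'.
  have Sm : S m `<=` E by rewrite ES => p; exists m.
  have [N [t [N0 t0 tm SE]]] := HS m.
  rewrite SE => -[/= jN /andP[tk kt]] [/= jN' /andP[tk' kt']].
  case: (ltnP k (t j.+1)) => [kt1|kt1].
    by left; apply: Sm; rewrite SE; split => //=; apply/andP; split => //; apply: leq_trans tk _.
  have kE : k = t j.+1 by apply/eqP; rewrite eqn_leq kt1 andbT.
  case: (ltnP j.+1 N) => [jN1|jN1].
    right; apply: Sm; rewrite SE; split => //=; rewrite -kE lexx /= kE.
    exact: tm.
  have jE : (j' <= j)%N by rewrite -ltnS; apply: leq_trans jN' jN1.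
  have : (k' <= k)%N.
    rewrite kE; apply: leq_trans kt' _.
    move: jE; rewrite leq_eqVlt => /predU1P[->//|jj].
    have : forall d, (j'.+1 + d <= N)%N -> (t j'.+1 <= t (j'.+1 + d)%N)%N.
      elim=> [|d IH]; first by rewrite addn0.
      rewrite addnS => dN; apply: leq_trans (IH (ltnW dN)) _.
      exact: tm.
    by move=> /(_ (j - j')%N); rewrite addSn subnKC ?(ltnW jj)//; exact.
  by lia.
have Hlev m : exists p : nat * nat, E p /\ (p.1 + p.2)%N = m.
  elim: m => [|m [[k j] [Ep pm]]]; first by exists (0%N, 0%N).
  by have [H|H] := Enext _ _ Ep; [exists (k.+1, j)|exists (k, j.+1)];
    split => //; rewrite /= -pm ?addSn ?addnS.
pose q m := sval (cid (Hlev m)).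
have qP m : E (q m) /\ ((q m).1 + (q m).2)%N = m by rewrite /q; case: cid.
have qE k j : E (k, j) -> q (k + j)%N = (k, j).
  move=> Ekj; have [Eq qq] := qP (k + j)%N.
  by case: (q _) Eq qq => k' j' /= Eq qq; have [-> ->] := Euniq _ _ _ _ Eq Ekj qq.
exists (fun m => (q m).1), (fun m => (q m).2); split.
  split; first by have := qE _ _ E00; rewrite addn0 => ->.
    by have := qE _ _ E00; rewrite addn0 => ->.
  move=> m; have [] := qP m; case: (q m) => k j /= Ekj <-.
  have [/qE|/qE] := Enext _ _ Ekj; rewrite ?addSn ?addnS => ->; [by left|by right].
move=> k j; split=> [/qE Eq|[m [<- <-]]]; first by exists (k + j)%N; rewrite Eq.
by have [] := qP m; case: (q m).
Qed.

(** * Integrals of step functions *)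

Section StepIntegral.
Context {R : realType} {n : nat}.
Variable (h : nat -> R).
Hypothesis hadm : admissible h.

Let h0 k : 0 < h k.+1. Proof. by case: hadm => + _ _; apply. Qed.

Lemma tau0 : tau h 0 = 0. Proof. by rewrite /tau big_geq. Qed.

Lemma tauS k : tau h k.+1 = tau h k + h k.+1.
Proof. by rewrite /tau big_nat_recr. Qed.

Lemma tau_le k l : (tau h k <= tau h l) = (k <= l)%N.
Proof.
have H : {homo tau h : i j / (i < j)%N >-> i < j}.
  by apply: homo_ltn => [? ? ?|i]; [exact: lt_trans|rewrite tauS ltrDl].
case: (leqP k l) => [|lk].
  by rewrite leq_eqVlt => /predU1P[->|/H/ltW//]; rewrite lexx.
by apply/negbTE; rewrite -ltNge H.
Qed.

Lemma tau_inj k l : tau h k = tau h l -> k = l.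
Proof.
by move=> H; apply/eqP; rewrite eqn_leq -!tau_le H lexx.
Qed.

Lemma tau_ge0 k : 0 <= tau h k. Proof. by rewrite -tau0 tau_le. Qed.

Lemma tau_unbounded (t : R) : exists k, t < tau h k.
Proof.
case: hadm => _ _ /cvgryPgt /(_ t)[N _ HN]; exists N; exact: HN (leqnn _).
Qed.

Lemma mtimeP t : 0 <= t -> tau h (mtime h t) <= t < tau h (mtime h t).+1.
Proof.
move=> t0; have [k tk] := tau_unbounded t.
have [l [lt Hl]] : exists l, tau h l <= t /\ forall i, tau h i <= t -> (i <= l)%N.
  elim: k tk => [|k IH] tk; first by move: tk; rewrite tau0 ltNge t0.
  case: (ltP t (tau h k)) => [/IH//|kt]; exists k; split => // i it.
  by rewrite -ltnS ltnNge -tau_le -ltNge; apply: le_lt_trans it tk.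
have -> : mtime h t = l.
  rewrite /mtime /nat_max; case: xgetP => [y _ [/= yt Hy]|/(_ l)[]].
    by apply/eqP; rewrite eqn_leq Hl// Hy.
  by split.
rewrite lt /= ltNge; apply/negP => /Hl; by rewrite ltnn.
Qed.

Lemma mtime_eq t k : tau h k <= t < tau h k.+1 -> mtime h t = k.
Proof.
move=> /andP[H1 H2]; have t0 : 0 <= t by apply: le_trans H1; exact: tau_ge0.
have /andP[H3 H4] := mtimeP t0.
apply/eqP; rewrite eqn_leq; apply/andP; split; rewrite -ltnS ltnNge -tau_le -ltNge.
  exact: le_lt_trans H3 H2.
exact: le_lt_trans H1 H4.
Qed.

Implicit Types (g : nat -> 'rV[R]_n).

(** The integral from [0] to [t] of the step function equal to [g k] on
    [[tau h k, tau h k.+1)]. *)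
Definition step_integral g (t : R) : 'rV[R]_n :=
  \sum_(0 <= i < mtime h t) h i.+1 *: g i + (t - tau h (mtime h t)) *: g (mtime h t).

Lemma step_integral_tau g k : step_integral g (tau h k) = \sum_(0 <= i < k) h i.+1 *: g i.
Proof.
rewrite /step_integral (@mtime_eq _ k) ?subrr ?scale0r ?addr0//.
by rewrite lexx tauS ltrDl h0.
Qed.

Lemma step_integralE g k t : tau h k <= t <= tau h k.+1 ->
  step_integral g t = step_integral g (tau h k) + (t - tau h k) *: g k.
Proof.
move=> /andP[kt]; rewrite step_integral_tau le_eqVlt => /predU1P[->|tk].
  by rewrite step_integral_tau big_nat_recr//= tauS addrAC subrr add0r.
by rewrite /step_integral (@mtime_eq _ k) ?kt.
Qed.

Lemma step_integralB g g' t :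
  step_integral (fun k => g k - g' k) t = step_integral g t - step_integral g' t.
Proof.
rewrite /step_integral opprD addrACA -scalerBr; congr (_ + _).
by rewrite -sumrB; apply: eq_bigr => i _; rewrite scalerBr.
Qed.

(** By induction on the number of steps met: the average over the union of two
    adjacent intervals is a convex combination of the averages over each. *)
Lemma step_integral_mean g (A : set 'rV[R]_n) (s t : R) :
  (forall x y (l : R), 0 <= l <= 1 -> A x -> A y -> A (l *: x + (1 - l) *: y)) ->
  0 <= s -> s < t ->
  (forall k, tau h k < t -> s < tau h k.+1 -> A (g k)) ->
  exists2 y, A y & step_integral g t - step_integral g s = (t - s) *: y.
Proof.
move=> cA s0; have [K] := tau_unbounded t => /ltW.
elim: K t => [|K IH] t tK st Hg.
  by move: tK; rewrite tau0 leNgt (le_lt_trans s0 st).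
case: (leP t (tau h K)) => [/IH|Kt]; first exact.
have tKK : tau h K <= t <= tau h K.+1 by rewrite (ltW Kt).
case: (leP (tau h K) s) => [Ks|sK].
  exists (g K); first by apply: Hg => //; apply: lt_le_trans st tK.
  have sKK : tau h K <= s <= tau h K.+1 by rewrite Ks (ltW (lt_le_trans st tK)).
  rewrite (step_integralE _ tKK) (step_integralE _ sKK) opprD addrACA subrr add0r.
  by rewrite -scalerBl; congr (_ *: _); ring.
have [|y Ay yE] := IH (tau h K) (lexx _) sK.
  by move=> k kK sk; apply: Hg => //; apply: lt_trans kK Kt.
have ts : 0 < t - s by rewrite subr_gt0.
(* The average over [s, t] weighs the average over [s, tau h K] by [l]. *)
pose l := (tau h K - s) / (t - s).
have l01 : 0 <= l <= 1.
  apply/andP; split; first by apply: divr_ge0; rewrite subr_ge0 ltW.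
  by rewrite /l ler_pdivrMr// mul1r lerD2r ltW.
exists (l *: y + (1 - l) *: g K).
  by apply: cA => //; apply: Hg => //; apply: lt_le_trans sK _; rewrite tau_le.
rewrite (step_integralE _ tKK) addrAC yE scalerDr !scalerA; congr (_ *: _ + _ *: _).
  by rewrite /l mulrCA mulfV ?mulr1// gt_eqF.
by rewrite /l mulrBr mulr1 mulrCA mulfV ?mulr1 ?gt_eqF//; ring.
Qed.

Lemma step_integral_lipschitz g (M s t : R) :
  0 <= s -> s <= t -> (forall k, tau h k < t -> s < tau h k.+1 -> `|g k| <= M) ->
  `|step_integral g t - step_integral g s| <= M * (t - s).
Proof.
move=> s0; rewrite le_eqVlt => /predU1P[->|st] Hg; first by rewrite !subrr normr0 mulr0.
have [|y /= yM ->] := @step_integral_mean g [set y | `|y| <= M] s t _ s0 st Hg.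
  move=> x y l /andP[l0 l1] /= xM yM; apply: le_trans (ler_normD _ _) _.
  rewrite !normrZ (ger0_norm l0) (ger0_norm (_ : 0 <= 1 - l)) ?subr_ge0//.
  have : 0 <= 1 - l by rewrite subr_ge0.
  move=> l1'; have := ler_wpM2l l0 xM; have := ler_wpM2l l1' yM; lra.
have ts : 0 <= t - s by rewrite subr_ge0 ltW.
by rewrite normrZ mulrC (ger0_norm ts) ler_wpM2r.
Qed.

(** A bounded interval meets finitely many steps. *)
Lemma step_integral_locally_lipschitz g (b : R) : exists M : R,
  forall s t, 0 <= s -> s <= t -> t <= b ->
    `|step_integral g t - step_integral g s| <= M * (t - s).
Proof.
have [K bK] := tau_unbounded b; exists (\sum_(i < K) `|g i|) => s t s0 st tb.
apply: step_integral_lipschitz => // k kt _.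
have kK : (k < K)%N.
  by rewrite ltnNge -tau_le -ltNge; apply: lt_le_trans kt _; apply: le_trans tb (ltW bK).
by rewrite (bigD1 (Ordinal kK))//= lerDl sumr_ge0.
Qed.

End StepIntegral.

(** * The interpolated mapping along the path *)

Section Interpolation.
Context {R : realType} {n : nat}.
Variables (phi : hmap nat R n) (h : nat -> R) (K J : nat -> nat).
Hypotheses (hadm : admissible h) (HP : lattice_path K J).
Hypothesis (HE : forall k j, hdom phi (k, j) <-> exists m, K m = k /\ J m = j).

Definition path_time (m : nat) : R := tau h (K m).
Definition path_state (m : nat) : 'rV[R]_n := hval phi (K m) (J m).

Notation T := path_time.
Notation X := path_state.
Notation P := (step_integral h (fhat phi h)).
Notation psi := (interpolated phi h).

Lemma path_dom m : hdom phi (K m, J m). Proof. by apply/HE; exists m. Qed.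

Lemma path_time_le m m' : (m <= m')%N -> T m <= T m'.
Proof. by move=> mm; rewrite /path_time tau_le// (path_leK HP). Qed.

Lemma path_time_ge0 m : 0 <= T m. Proof. exact: tau_ge0. Qed.

Lemma jump_time m : J m.+1 = (J m).+1 -> T m.+1 = T m.
Proof.
by case: HP => _ _ /(_ m)[[_ ->]|[KE _ _]]; [lia|rewrite /path_time KE].
Qed.

Lemma flow_step m : K m.+1 = (K m).+1 -> J m.+1 = J m.
Proof. by case: HP => _ _ /(_ m)[[_ ->]//|[-> _]]; lia. Qed.

Lemma path_cases m : (K m.+1 = (K m).+1 /\ J m.+1 = J m) \/
  (K m.+1 = K m /\ J m.+1 = (J m).+1).
Proof. by case: HP. Qed.

Lemma flow_interval m : K m.+1 = (K m).+1 -> T m.+1 = tau h (K m).+1.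
Proof. by rewrite /path_time => ->. Qed.

(** A jump step has [T m.+1 = T m], so that it contributes a single point: flow
    steps and jumps need not be told apart. *)
Lemma interpolated_domP t j :
  hdom psi (t, j) <-> exists m, [/\ J m = j, T m <= t & t <= T m.+1].
Proof.
split=> [[/= t1 [t2 [[k1 /HE[m1 [K1 J1]] /= T1] [k2 /HE[m2 [K2 J2]] /= T2] /andP[t1t tt2]]]]|].
  have {k1 K1 t1 T1 t1t} t1t : T m1 <= t by rewrite /path_time K1 -T1.
  have {k2 K2 t2 T2 tt2} tt2 : t <= T m2 by rewrite /path_time K2 -T2.
  have [/eqP tE|Tt] := eqVneq t (T m2).
    exists m2; split => //; first by rewrite (eqP tE).
    by apply: le_trans tt2 _; exact: path_time_le.
  have {Tt} tT : t < T m2 by rewrite lt_neqAle Tt.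
  have [d m2E] : exists d, m2 = (m1 + d)%N.
    exists (m2 - m1)%N; rewrite subnKC// leqNgt; apply/negP => mm.
    by have := path_time_le (ltnW mm); rewrite leNgt (le_lt_trans t1t tT).
  subst m2; elim: d J2 tT {tt2} => [|d IH] J2 tT.
    by move: tT; rewrite addn0 ltNge t1t.
  have Jd : J (m1 + d)%N = j.
    by rewrite -J1; apply: (path_constJ HP (leq_addr _ _) (m' := (m1 + d.+1)%N));
      rewrite ?J1// leq_add2l.
  case: (leP (T (m1 + d)%N) t) => [H|H]; last exact: IH.
  by exists (m1 + d)%N; split => //; rewrite -addnS ltW.
move=> [m [Jm H1 H2]]; exists (T m), (T m.+1).
have dm : hdom (compressed phi h) (T m, j) by exists (K m) => //=; rewrite -Jm; exact: path_dom.
have [[Km Jm1]|[Km Jm1]] := path_cases m.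
  split => //=; last by rewrite H1.
  by exists (K m.+1) => //=; rewrite -Jm -Jm1; exact: path_dom.
by rewrite jump_time// in H2 *; split => //=; rewrite H1.
Qed.

(** The path is ordered, so the first point with a given [k] comes from a flow step,
    and likewise for jumps below. *)
Lemma jbar_flow m : K m.+1 = (K m).+1 -> jbar phi (K m) = J m.
Proof.
move=> Km; have Jm := flow_step Km; rewrite /jbar /nat_min.
have minJ l : hdom phi ((K m).+1, l) -> (J m <= l)%N.
  move=> /HE[m' [Km' Jm']]; rewrite -Jm'; apply: (path_leJ HP).
  rewrite leqNgt; apply/negP => /ltnW/(path_leK HP); rewrite Km'; lia.
have dJ : hdom phi ((K m).+1, J m) by rewrite -Km -Jm; exact: path_dom.
case: xgetP => [y _ [/= dy Hy]|/(_ (J m))[]]; last by split.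
by apply/eqP; rewrite eqn_leq Hy// minJ.
Qed.

Lemma kbar_jump m : J m.+1 = (J m).+1 -> kbar phi (J m) = K m.
Proof.
move=> Jm; rewrite /kbar /nat_min.
have Km : K m.+1 = K m.
  by have [[_]|[]] := path_cases m; rewrite ?Jm//; lia.
have minK l : hdom phi (l, (J m).+1) -> (K m <= l)%N.
  move=> /HE[m' [Km' Jm']]; rewrite -Km'; apply: (path_leK HP).
  rewrite leqNgt; apply/negP => /ltnW/(path_leJ HP); rewrite Jm'; lia.
have dK : hdom phi (K m, (J m).+1) by rewrite -Km -Jm; exact: path_dom.
case: xgetP => [y _ [/= dy Hy]|/(_ (K m))[]]; last by split.
by apply/eqP; rewrite eqn_leq Hy// minK.
Qed.

Lemma flow_increment m : K m.+1 = (K m).+1 -> X m.+1 - X m = P (T m.+1) - P (T m).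
Proof.
move=> Km; have Jm := flow_step Km.
rewrite (@step_integralE _ _ _ hadm _ (K m) (T m.+1)); last first.
  by rewrite /path_time Km lexx (tau_le hadm) leqnSn.
rewrite addrAC subrr add0r /path_time Km tauS addrAC subrr add0r /fhat (jbar_flow Km).
rewrite scalerA mulfV ?scale1r; last by case: hadm => h0 _ _; rewrite gt_eqF// h0.
by rewrite /path_state Km Jm.
Qed.

Lemma same_jump_increment m m' : J m = J m' -> X m' - X m = P (T m') - P (T m).
Proof.
wlog mm : m m' / (m <= m')%N.
  move=> H JJ; case: (leqP m m') => [/H|/ltnW/H H']; first exact.
  by rewrite -opprB H'// opprB.
rewrite -(subnKC mm); move: (m' - m)%N => d; elim: d => [|d IH] JJ.
  by rewrite addn0 !subrr.
have Jd : J (m + d)%N = J m.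
  by apply: (path_constJ HP (m' := (m + d.+1)%N)); rewrite ?leq_addr ?leq_add2l.
have KK : K (m + d).+1 = (K (m + d)%N).+1.
  by have [[]//|[_]] := path_cases (m + d); rewrite -addnS -JJ Jd; lia.
rewrite addnS; have := flow_increment KK; have := IH (esym Jd).
move=> /(canRL (subrK _)) -> /(canRL (subrK _)) ->.
by rewrite [X in X - _]addrA addrK subrKA.
Qed.

(** Over one slice the interpolation is, up to a constant, the integral of [fhat],
    a function of time alone; this is what makes its increments additive.  The base
    point [m] is arbitrary because the path itself has this property. *)
Lemma interpolatedE m t j : J m = j -> hdom psi (t, j) ->
  hval psi t j = X m + (P t - P (T m)).
Proof.
move=> Jm /interpolated_domP[m0 [J0 T0 T1]].
(* All three clauses of the definition are instances of this formula. *)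
have key k x : hdom phi (k, j) -> tau h k <= t <= tau h k.+1 ->
    x = hval phi k j + (P t - P (tau h k)) -> x = X m + (P t - P (T m)).
  move=> /HE[m' [Km' Jm']] tk ->; rewrite -Km' -Jm'.
  have /same_jump_increment : J m = J m' by rewrite Jm Jm'.
  rewrite /path_state /path_time => /(canRL (subrK _)) ->.
  by rewrite addrC [in RHS]addrC addrA; congr (_ + _); rewrite subrKA.
have key1 k : hdom phi (k, j) -> t = tau h k -> hval phi k j = X m + (P t - P (T m)).
  move=> dk tE; apply: (key k) => //; first by rewrite tE lexx (tau_le hadm) leqnSn.
  by rewrite tE subrr addr0.
rewrite /interpolated /=; case: xgetP => [x _ []|].
- move=> [k [dk dk1 tk xE]]; apply: (key k) => //; rewrite xE; congr (_ + _).
  rewrite (step_integralE hadm _ tk) addrAC subrr add0r /fhat.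
  have [m' [Km' Jm']] := (HE _ _).1 dk.
  have [m1 [Km1 Jm1]] := (HE _ _).1 dk1.
  have m1E : m1 = m'.+1 by have := path_sum HP m1; have := path_sum HP m'; lia.
  have := @jbar_flow m'; rewrite Km' -m1E Km1 => /(_ erefl) ->.
  by rewrite Jm' scalerA.
- by move=> [k [dk dk1 tE ->]]; exact: key1.
- by move=> [k [i [ji dk dk1 tE ->]]]; rewrite -ji; apply: key1 => //; rewrite ji.
move=> Hn; exfalso.
have [[Km Jm1]|[Km Jm1]] := path_cases m0.
  apply: (Hn (hval phi (K m0) j + ((t - tau h (K m0)) / h (K m0).+1) *:
                   (hval phi (K m0).+1 j - hval phi (K m0) j))).
  apply: Or31; exists (K m0); split => //.
  - by rewrite -J0; exact: path_dom.
  - by rewrite -J0 -Km -Jm1; exact: path_dom.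
  - by rewrite -flow_interval// T1 andbT.
apply: (Hn (hval phi (K m0) j)); apply: Or32; exists (K m0); split => //.
- by rewrite -J0; exact: path_dom.
- by rewrite -J0 -Km -Jm1; exact: path_dom.
- by rewrite jump_time// in T1; apply/eqP; rewrite eq_le T1.
Qed.

Lemma interpolated_path m : hval psi (T m) (J m) = X m.
Proof.
rewrite (@interpolatedE m _ (J m))// ?subrr ?addr0//.
by apply/interpolated_domP; exists m; rewrite lexx path_time_le.
Qed.

Lemma interpolated_increment s t j : hdom psi (s, j) -> hdom psi (t, j) ->
  hval psi t j - hval psi s j = P t - P s.
Proof.
move=> ds dt; have [m [Jm _ _]] := (interpolated_domP _ _).1 ds.
rewrite !(@interpolatedE m)// [X in X - _]addrC addrKA.
by rewrite opprB subrKA.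
Qed.

Lemma compressed_domP t j :
  hdom (compressed phi h) (t, j) <-> exists m, J m = j /\ t = T m.
Proof.
split=> [[/= k /HE[m [<- Jm]] ->]|[m [<- ->]]]; first by exists m.
by exists (K m) => //=; exact: path_dom.
Qed.

Lemma compressedE m : hval (compressed phi h) (T m) (J m) = X m.
Proof.
rewrite /=; case: xgetP => [x _ [k [dk]]|/(_ (X m))[]].
  by move=> /(tau_inj hadm) <- ->.
by exists (K m); split => //; exact: path_dom.
Qed.

Lemma interpolated_ge0 t j : hdom psi (t, j) -> 0 <= t.
Proof. by move=> /interpolated_domP[m [_ + _]]; apply: le_trans; exact: path_time_ge0. Qed.

Lemma interpolated_convex : slices_convex (hdom psi).
Proof.
move=> t s r j [t1 [_ [d1 _ /andP[t1t _]]]] [_ [s2 [_ d2 /andP[_ ss2]]]] tr rs.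
exists t1, s2; split => //=; apply/andP; split.
  exact: le_trans t1t tr.
exact: le_trans rs ss2.
Qed.

Lemma interpolated_mono t j s i : hdom psi (t, j) -> hdom psi (s, i) ->
  (j < i)%N -> t <= s.
Proof.
move=> /interpolated_domP[m [Jm _ tT]] /interpolated_domP[m' [Jm' Ts _]] ji.
apply: le_trans tT _; apply: le_trans Ts; apply: path_time_le.
by rewrite ltnNge; apply/negP => /(path_leJ HP); rewrite Jm Jm' leqNgt ji.
Qed.

Lemma interpolated_abut : slices_abut (hdom psi).
Proof.
move=> t j d; have [m [Jm _ _]] := (interpolated_domP _ _).1 d.
have [m0 [Jm0 Jm1]] : exists m0, J m0 = j /\ J m0.+1 = j.+1.
  elim: m Jm {d} => [|m IH]; first by case: HP => _ ->.
  have [[_ ->]|[_ Jm]] := path_cases m; first exact: IH.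
  by move=> Jm'; exists m; split => //; move: Jm'; rewrite Jm => -[].
have d0 : hdom psi (T m0, j).
  by apply/interpolated_domP; exists m0; rewrite lexx path_time_le.
have d1 : hdom psi (T m0, j.+1).
  apply/interpolated_domP; exists m0.+1; split; first exact: Jm1.
    by rewrite jump_time ?Jm1 ?Jm0.
  by apply: path_time_le; rewrite -addn2 leq_addr.
exists (T m0); split => // s ds; first exact: interpolated_mono ds d1 _.
exact: interpolated_mono d0 ds _.
Qed.

Lemma interpolated_hybrid_domain : hybrid_domain 0 (hdom psi).
Proof.
have [K0 J0 _] := HP.
apply: hybrid_domain_slices.
- by apply/interpolated_domP; exists 0%N; rewrite path_time_ge0 {1}/path_time K0 tau0 lexx.
- by move=> t; exact: interpolated_ge0.
- exact: interpolated_convex.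
- exact: interpolated_abut.
(* Without a further jump all later steps are flow steps in slice [j]. *)
move=> t j /interpolated_domP[m [Jm _ _]] Hn.
have Jd d : J (m + d)%N = j.
  elim: d => [|d IH]; first by rewrite addn0.
  rewrite addnS; have [[_ ->]//|[_ JS]] := path_cases (m + d).
  exfalso; apply: (Hn (T (m + d).+1)); apply/interpolated_domP; exists (m + d).+1.
  by rewrite JS IH lexx path_time_le.
exists (fun d => T (m + d)%N); split.
- by move=> d; apply/interpolated_domP; exists (m + d)%N; rewrite Jd lexx path_time_le.
- by move=> d; rewrite path_time_le// addnS.
move=> s /interpolated_domP[m' [_ _ sT]]; exists m'.+1; apply: le_trans sT _.
by rewrite path_time_le// leq_addl.
Qed.

End Interpolation.

(** * Late behaviour of an asymptotic simulation *)

Lemma nat_mono_dichotomy (K : nat -> nat) : (forall m m', (m <= m')%N -> (K m <= K m')%N) ->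
  (forall N, exists M, (N <= K M)%N) \/ (exists M, forall m, (M <= m)%N -> K m = K M).
Proof.
move=> mono; have [|/existsNP[N HN]] := pselect (forall N, exists M, (N <= K M)%N).
  by left.
right; have {}HN M : (K M < N)%N by rewrite ltnNge; apply/negP => NM; apply: HN; exists M.
elim: N HN => [|N IH] HN; first by have := HN 0%N.
have [[M NM]|Hn] := pselect (exists M, (N <= K M)%N).
  exists M => m Mm; apply/eqP; rewrite eqn_leq; apply/andP; split; last exact: mono.
  by apply: leq_trans NM; exact: HN.
by apply: IH => M; rewrite ltnNge; apply/negP => NM; apply: Hn; exists M.
Qed.

(** Otherwise the terms at distance more than [e] from [Z] would, by compactness,
    have a cluster point outside [Z]. *)
Lemma cluster_near {R : realType} {n : nat} (u v : nat -> 'rV[R]_n) (M e : R)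
    (Z : set ('rV[R]_n * 'rV[R]_n)) :
  (forall k, `|u k| <= M) -> (forall k, `|v k| <= M) ->
  cluster ((u k, v k) @[k --> \oo]) `<=` Z -> 0 < e ->
  exists N, forall k, (N <= k)%N ->
    exists x y, [/\ Z (x, y), `|u k - x| <= e & `|v k - y| <= e].
Proof.
move=> uM vM Hcl e0; apply: contrapT => Hn.
have H N : exists k, (N <= k)%N /\
    forall x y, Z (x, y) -> ~ (`|u k - x| <= e /\ `|v k - y| <= e).
  apply: contrapT => H1; apply: Hn; exists N => k Nk; apply: contrapT => H2.
  apply: H1; exists k; split => // x y Zxy [H3 H4]; apply: H2; by exists x, y.
pose s N := sval (cid (H N)).
have sP N : (N <= s N)%N /\
  forall x y, Z (x, y) -> ~ (`|u (s N) - x| <= e /\ `|v (s N) - y| <= e).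
  by rewrite /s; case: cid.
have [l1 [g1 Hg1]] := compact_subseq (norm_bounded_compact (M:=M))
  (fun N => uM (s N) : [set x | `|x| <= M] _).
have [l2 [g2 Hg2]] := compact_subseq (norm_bounded_compact (M:=M))
  (fun N => vM (s (g1 N)) : [set x | `|x| <= M] _).
pose r N := s (g1 (g2 N)).
have rN N : (N <= r N)%N.
  apply: leq_trans (sP _).1; apply: leq_trans (Hg1 _).1; exact: (Hg2 _).1.
have Zl : Z (l1, l2).
  apply: Hcl => A B [N0 _ HA] /nbhs_ballP[d /= d0 HB].
  have [N1 HN1] := invS_small d0.
  pose N := maxn N0 N1; exists (u (r N), v (r N)); split.
    apply: HA => /=; apply: leq_trans (rN N); exact: leq_maxl.
  apply: HB; split; rewrite -ball_normE /ball_/= distrC.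
    apply: lt_trans (Hg1 _).2 _; apply: HN1; apply: leq_trans (Hg2 _).1; exact: leq_maxr.
  apply: lt_trans (Hg2 _).2 _; apply: HN1; exact: leq_maxr.
have [N1 HN1] := invS_small e0.
have := (sP (g1 (g2 N1))).2 _ _ Zl; apply; split; apply: ltW.
  by apply: lt_trans (Hg1 _).2 _; apply: HN1; exact: (Hg2 _).1.
by apply: lt_trans (Hg2 _).2 _; exact: HN1.
Qed.

Section SmallNoise.
Context {R : realType} {n : nat}.
Variables (h : nat -> R) (g : nat -> 'rV[R]_n) (T0 : R).
Hypotheses (hadm : admissible h) (T0_gt0 : 0 < T0).
Hypothesis Hsup : sup [set enorm (\sum_(k <= i < l) h i.+1 *: g i) | l in
    [set l | (k.+1 <= l <= mtime h (tau h k + T0))%N]] @[k --> \oo] --> 0.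

Notation N := (step_integral h g).

Lemma step_small (e : R) : 0 < e -> exists M, forall k, (M <= k)%N -> h k.+1 <= e.
Proof.
case: hadm => h0 /cvgrPdist_lt /(_ e) + _ => /[apply] -[M _ HM]; exists M => k Mk.
have := HM k.+1 (leqW Mk); rewrite /= sub0r normrN => /ltW; apply: le_trans.
exact: ler_norm.
Qed.

Let window (e : R) : 0 < e -> exists M, forall k l, (M <= k)%N -> (k <= l)%N ->
  tau h l <= tau h k + T0 -> `|N (tau h l) - N (tau h k)| <= e.
Proof.
move=> e0; move/cvgrPdist_lt : Hsup => /(_ e e0)[M _ HM]; exists M => k l Mk.
rewrite leq_eqVlt => /predU1P[->|kl] kT; first by rewrite subrr normr0 ltW.
have := HM k Mk; rewrite /= sub0r normrN => /ltW; apply: le_trans.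
apply: le_trans (ler_norm _).
rewrite !(step_integral_tau hadm) (big_cat_nat (leq0n k) (ltnW kl))/= addrAC subrr add0r.
apply: le_trans (norm_le_enorm _) _.
set S := [set _ | _ in _].
apply: (@ub_le_sup _ S).
  exists (\sum_(i < (mtime h (tau h k + T0)).+1) enorm (\sum_(k <= j < i) h j.+1 *: g j)).
  move=> _ [l' /andP[_ l'm] <-].
  rewrite (bigD1 (Ordinal (n:=(mtime h (tau h k + T0)).+1) (m:=l') l'm))//= lerDl.
  by apply: sumr_ge0 => i _; exact: sqrtr_ge0.
exists l => //=; rewrite kl/=.
have kT0 : 0 <= tau h k + T0 by rewrite addr_ge0 ?(tau_ge0 hadm)// ltW.
have /andP[_ H2] := mtimeP hadm kT0.
by rewrite -ltnS ltnNge -(tau_le hadm) -ltNge; exact: le_lt_trans kT H2.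
Qed.

(** Longer windows are covered by windows of length [T0], each of which advances
    by at least [T0 / 2] once the steps are that short. *)
Let long_window (q : nat) (e : R) : 0 < e -> exists M, forall k l, (M <= k)%N -> (k <= l)%N ->
  tau h l <= tau h k + q%:R * (T0 / 2) -> `|N (tau h l) - N (tau h k)| <= e.
Proof.
elim: q e => [|q IH] e e0.
  exists 0%N => k l _ kl; rewrite mul0r addr0 (tau_le hadm) => lk.
  have -> : l = k by apply/eqP; rewrite eqn_leq lk kl.
  by rewrite subrr normr0 ltW.
have e2 : 0 < e / 2 by rewrite divr_gt0.
have T2 : 0 < T0 / 2 by rewrite divr_gt0.
have [M1 H1] := IH _ e2; have [M2 H2] := window e2; have [M3 H3] := step_small T2.
exists (maxn M1 (maxn M2 M3)) => k l; rewrite !geq_max => /and3P[Mk1 Mk2 Mk3] kl klT.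
case: (leP (tau h l) (tau h k + T0)) => [lT|Tl].
  by apply: le_trans (H2 _ _ Mk2 kl lT) _; lra.
have kT0 : 0 <= tau h k + T0 by rewrite addr_ge0 ?(tau_ge0 hadm)// ltW.
have := mtimeP hadm kT0; set k' := mtime _ _ => /andP[k1 k2].
have kk' : (k <= k')%N.
  rewrite -ltnS -ltnS ltnS ltnNge -(tau_le hadm) -ltNge; apply: le_lt_trans k2.
  by rewrite lerDl ltW.
have k'l : (k' <= l)%N by rewrite -(tau_le hadm) ltW// (le_lt_trans k1 Tl).
have A1 := H2 _ _ Mk2 kk' k1.
have A2 : `|N (tau h l) - N (tau h k')| <= e / 2.
  apply: (H1 _ _ (leq_trans Mk1 kk') k'l).
  move: k2; rewrite tauS; have := H3 _ (leq_trans Mk3 kk'); move: klT.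
  rewrite -natr1 mulrDl mul1r; lra.
rewrite -(subrKA (N (tau h k'))); apply: le_trans (ler_normD _ _) _; lra.
Qed.

Lemma noise_small (th e : R) : 0 < e -> exists M, forall k t, (M <= k)%N ->
  tau h k <= t -> t <= tau h k + th -> `|N t - N (tau h k)| <= e.
Proof.
move=> e0; have e2 : 0 < e / 2 by rewrite divr_gt0.
have T2 : 0 < T0 / 2 by rewrite divr_gt0.
(* This many half-windows cover a window of length [th]. *)
pose q := (Num.truncn (`|th| / (T0 / 2))).+1.
have [M1 H1] := long_window q e2; have [M2 H2] := window e2.
have [M3 H3] := step_small T0_gt0.
exists (maxn M1 (maxn M2 M3)) => k t; rewrite !geq_max => /and3P[Mk1 Mk2 Mk3] kt tk.
have t0 : 0 <= t by apply: le_trans kt; exact: tau_ge0.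
have := mtimeP hadm t0; set l := mtime _ _ => /andP[lt tl].
have kl : (k <= l)%N.
  by rewrite -ltnS ltnNge -(tau_le hadm) -ltNge; apply: le_lt_trans tl.
have A1 : `|N (tau h l) - N (tau h k)| <= e / 2.
  apply: H1 => //; apply: le_trans lt _; apply: le_trans tk _; rewrite lerD2l.
  apply: le_trans (ler_norm _) _; rewrite -ler_pdivrMr//.
  by rewrite ltW// /q truncnS_gt.
have A2 : `|N (tau h l.+1) - N (tau h l)| <= e / 2.
  apply: H2 => //; first exact: leq_trans Mk2 kl.
  by rewrite tauS lerD2l; apply: H3; exact: leq_trans Mk3 kl.
(* Within one step the noise grows linearly. *)
have A3 : `|N t - N (tau h l)| <= e / 2.
  apply: le_trans A2.
  have tl1 : tau h l <= t <= tau h l.+1 by rewrite lt ltW.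
  have tl2 : tau h l <= tau h l.+1 <= tau h l.+1 by rewrite lexx (tau_le hadm) leqnSn.
  rewrite (step_integralE hadm g tl1) (step_integralE hadm g tl2).
  rewrite addrAC subrr add0r addrAC subrr add0r !normrZ ler_wpM2r//.
  by rewrite !ger0_norm ?subr_ge0 ?lerD2r ?(ltW tl)// (le_trans lt (ltW tl)).
rewrite -(subrKA (N (tau h l))); apply: le_trans (ler_normD _ _) _; lra.
Qed.

End SmallNoise.

(** The conditions of an asymptotic simulation, restated along the path.  They hold
    whether or not the sequence is complete in the [k] or [j] direction, since a
    direction in which it is not complete contributes finitely many steps.  The
    proviso [exists m'] in the third clause keeps [t] within the time span of the
    path, which is bounded when there are finitely many flow steps. *)
Record tracks {R : realType} {n : nat} (H : hybrid_data R n) (phi : hmap nat R n)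
    (h : nat -> R) (K J : nat -> nat) (f : nat -> 'rV[R]_n) : Prop := Tracks {
  tracks_flow : forall e : R, 0 < e -> exists M, forall m, (M <= m)%N ->
    K m.+1 = (K m).+1 -> exists x y, [/\ flow_set H x, flow_map H x y,
      `|path_state phi K J m - x| <= e & `|f (K m) - y| <= e];
  tracks_jump : forall e : R, 0 < e -> exists M, forall m, (M <= m)%N ->
    J m.+1 = (J m).+1 -> exists x y, [/\ jump_set H x, jump_map H x y,
      `|path_state phi K J m - x| <= e & `|path_state phi K J m.+1 - y| <= e];
  tracks_noise : forall th e : R, 0 < e -> exists M, forall m t, (M <= m)%N ->
    path_time h K m <= t -> t <= path_time h K m + th ->
    (exists m', t <= path_time h K m') ->
    `|step_integral h (fun k => fhat phi h k - f k) t
      - step_integral h (fun k => fhat phi h k - f k) (path_time h K m)| <= e;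
  tracks_bounded : exists2 Mf, 0 < Mf & forall k, `|f k| <= Mf }.

Lemma simulation_tracks {R : realType} {n : nat} (H : hybrid_data R n)
    (phi : hmap nat R n) (h : nat -> R) (K J : nat -> nat) :
  asymptotic_simulation H phi h -> lattice_path K J ->
  (forall k j, hdom phi (k, j) <-> exists m, K m = k /\ J m = j) ->
  exists f, tracks H phi h K J f.
Proof.
move=> [hadm [_ [/bounded_setPle[B B0 HB] _]] Hk Hj] HP HE.
have XB k j : hdom phi (k, j) -> `|hval phi k j| <= B by move=> d; apply: HB; exists (k, j).
have jumpP : forall e : R, 0 < e -> exists M, forall m, (M <= m)%N ->
    J m.+1 = (J m).+1 -> exists x y, [/\ jump_set H x, jump_map H x y,
      `|path_state phi K J m - x| <= e & `|path_state phi K J m.+1 - y| <= e].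
  move=> e e0; have [JU|[M HM]] := nat_mono_dichotomy (path_leJ HP); last first.
    exists M => m Mm; rewrite !HM ?leqW//; lia.
  have /Hj Hcl : j_complete phi.
    by move=> N; have [M NM] := JU N; exists (K M), (J M); split => //; apply/HE; exists M.
  have jumpat j : exists m, J m = j /\ J m.+1 = j.+1.
    have [M jM] := JU j.+1; elim: M jM => [|M IH]; first by case: HP => _ ->.
    have [[_ ->]//|[_ JS]] := path_cases HP M; rewrite JS ltnS leq_eqVlt.
    by case/predU1P => [->|/IH//]; exists M.
  have dj j : hdom phi (kbar phi j, j) /\ hdom phi (kbar phi j, j.+1).
    have [m [Jm Jm1]] := jumpat j.
    have KE : kbar phi j = K m by rewrite -Jm; apply: (kbar_jump HP HE); rewrite Jm.
    have K1 : K m.+1 = K m by have [[_]|[]//] := path_cases HP m; lia.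
    by split; apply/HE; [exists m|exists m.+1]; rewrite KE.
  have [N HN] := cluster_near (fun j => XB _ _ (dj j).1) (fun j => XB _ _ (dj j).2) Hcl e0.
  have [M NM] := JU N; exists M => m Mm Jm.
  have := HN (J m) (leq_trans NM (path_leJ HP Mm)).
  rewrite (kbar_jump HP HE Jm) => -[x [y [[/= Gxy [Dx _]] H1 H2]]].
  have K1 : K m.+1 = K m by have [[_]|[]//] := path_cases HP m; lia.
  by exists x, y; split => //; rewrite /path_state Jm K1.
have [KU|[M HM]] := nat_mono_dichotomy (path_leK HP); last first.
  (* Finitely many flow steps: any bounded [f] will do. *)
  exists (fun _ => 0); split.
  - move=> e e0; exists M => m Mm; rewrite !HM ?leqW//; lia.
  - exact: jumpP.
  - move=> th e e0; exists M => m t Mm mt _ [m' tm'].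
    suff -> : t = path_time h K m by rewrite subrr normr0 ltW.
    apply/eqP; rewrite eq_le mt andbT; apply: le_trans tm' _.
    apply: (@le_trans _ _ (path_time h K (maxn m m'))).
      by apply: (path_time_le hadm HP); exact: leq_maxr.
    by rewrite /path_time HM ?(HM m)//; apply: leq_trans Mm (leq_maxl _ _).
  - by exists 1 => // k; rewrite normr0.
have /Hk[f [/bounded_setPle[Mf Mf0 HMf] Hcl [T0 T00 Hsup]]] : k_complete phi.
  by move=> N; have [M NM] := KU N; exists (K M), (J M); split => //; apply/HE; exists M.
have flowat k : exists m, K m = k /\ K m.+1 = k.+1.
  have [M kM] := KU k.+1; elim: M kM => [|M IH]; first by case: HP => ->.
  have [[KS _]|[-> _]//] := path_cases HP M; rewrite KS ltnS leq_eqVlt.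
  by case/predU1P => [->|/IH//]; exists M.
have dk k : hdom phi (k, jbar phi k).
  have [m [Km Km1]] := flowat k.
  have JE : jbar phi k = J m by rewrite -Km; apply: (jbar_flow HP HE); rewrite Km.
  by apply/HE; exists m; rewrite JE.
have fM k : `|f k| <= Mf by apply: HMf; exists k.
exists f; split.
- move=> e e0.
  have [N HN] := @cluster_near _ _ _ _ (B + Mf) e _
    (fun k => le_trans (XB _ _ (dk k)) (ler_wpDr (ltW Mf0) (lexx B)))
    (fun k => le_trans (fM k) (ler_wpDl (ltW B0) (lexx Mf))) Hcl e0.
  have [M NM] := KU N; exists M => m Mm Km.
  have := HN (K m) (leq_trans NM (path_leK HP Mm)).
  rewrite (jbar_flow HP HE Km) => -[x [y [[/= Fxy [Cx _]] H1 H2]]].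
  by exists x, y.
- exact: jumpP.
- move=> th e e0; have [N HN] := noise_small hadm T00 Hsup th e0.
  have [M NM] := KU N; exists M => m t Mm mt tm _; apply: HN => //.
  exact: leq_trans NM (path_leK HP Mm).
- by exists Mf.
Qed.

(** * Late parts of the interpolated mapping *)

(** What survives of [tracks] once stated for the interpolated arc alone, in hybrid
    time: the form in which it passes to graphical limits.  Differential inclusions
    appear through increments: [arc_slope] compares the average velocity over a short
    interval, on which the arc stays close to [x0], with the values of the flow map
    at [x0]. *)
Record arc_tracks {R : realType} {n : nat} (H : hybrid_data R n) (psi : hmap R R n)
    (L : R) : Prop := ArcTracks {
  arc_ge0 : forall t j, hdom psi (t, j) -> 0 <= t;
  arc_convex : slices_convex (hdom psi);
  arc_mono : forall t j s i, hdom psi (t, j) -> hdom psi (s, i) -> (j < i)%N -> t <= s;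
  arc_abut : slices_abut (hdom psi);
  arc_progress : forall s i r, hdom psi (s, i) -> 0 <= r -> exists t j,
    [/\ hdom psi (t, j), s <= t, (i <= j)%N &
        s + i%:R + r <= t + j%:R <= s + i%:R + r + 1];
  arc_bounded : exists B : R, forall t j, hdom psi (t, j) -> `|hval psi t j| <= B;
  arc_increment : forall th e : R, 0 < e -> exists kappa : R, forall s t j,
    kappa <= s + j%:R -> hdom psi (s, j) -> hdom psi (t, j) -> s <= t -> t <= s + th ->
    `|hval psi t j - hval psi s j| <= L * (t - s) + e;
  arc_initial : forall e : R, 0 < e -> exists kappa : R, forall s j,
    kappa <= s + j%:R -> hdom psi (s, j) ->
    exists x, (flow_set H `|` jump_set H) x /\ `|hval psi s j - x| <= e;
  arc_flow : forall e : R, 0 < e -> exists kappa : R, forall s t j,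
    kappa <= s + j%:R -> hdom psi (s, j) -> hdom psi (t, j) -> s < t ->
    exists x, flow_set H x /\ `|hval psi s j - x| <= e;
  arc_slope : forall x0 (eta : R), flow_set H x0 -> 0 < eta -> exists2 rho : R, 0 < rho &
    forall e : R, 0 < e -> exists kappa : R, forall s t j,
    kappa <= s + j%:R -> hdom psi (s, j) -> hdom psi (t, j) -> s < t -> t <= s + 1 ->
    (forall r, s <= r -> r <= t -> `|hval psi r j - x0| < rho) ->
    exists z, flow_map H x0 z /\
      `|hval psi t j - hval psi s j - (t - s) *: z| <= eta * (t - s) + e;
  arc_jump : forall e : R, 0 < e -> exists kappa : R, forall t j,
    kappa <= t + j%:R -> hdom psi (t, j) -> hdom psi (t, j.+1) ->
    exists x y, [/\ jump_set H x, jump_map H x y, `|hval psi t j - x| <= e &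
      `|hval psi t j.+1 - y| <= e] }.

Section Tracking.
Context {R : realType} {n : nat}.
Variables (H : hybrid_data R n) (phi : hmap nat R n) (h : nat -> R).
Variables (K J : nat -> nat) (f : nat -> 'rV[R]_n).
Hypotheses (hadm : admissible h) (HP : lattice_path K J).
Hypothesis (HE : forall k j, hdom phi (k, j) <-> exists m, K m = k /\ J m = j).
Hypothesis (HT : tracks H phi h K J f).
Hypothesis (HB : hmap_bounded phi).

Notation T := (path_time h K).
Notation X := (path_state phi K J).
Notation psi := (interpolated phi h).
Notation N := (step_integral h (fun k => fhat phi h k - f k)).
Notation I := (step_integral h f).

Let dom_iff := interpolated_domP hadm HP HE.

Lemma level_unbounded (v : R) : exists m, v <= T m + (J m)%:R.
Proof.
have [KU|[M HM]] := nat_mono_dichotomy (path_leK HP).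
  have [k vk] := tau_unbounded hadm v; have [m km] := KU k; exists m.
  apply: le_trans (ltW vk) _; apply: ler_wpDr => //.
  by rewrite /path_time (tau_le hadm).
have [JU|[M' HM']] := nat_mono_dichotomy (path_leJ HP).
  have [m Jm] := JU (Num.truncn v).+1; exists m.
  apply: le_trans (ltW (truncnS_gt v)) _.
  by apply: ler_wpDl; [exact: (path_time_ge0 K hadm)|rewrite ler_nat].
pose m := maxn M M'.
have := path_sum HP m.+1; rewrite HM ?HM' ?leqW ?leq_maxl ?leq_maxr//.
have := path_sum HP m; rewrite HM ?HM' ?leq_maxl ?leq_maxr//; lia.
Qed.

(** The points of the path before index [M] have bounded hybrid time. *)
Lemma late_index (M : nat) : exists2 kappa : R, 0 < kappa & forall m t,
  T m <= t -> t <= T m.+1 -> kappa <= t + (J m)%:R -> (M <= m)%N.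
Proof.
exists (T M + (J M)%:R + 1) => [|m t Tt tT kt].
  by rewrite ltr_wpDl// addr_ge0// (path_time_ge0 K hadm).
rewrite leqNgt; apply/negP => mM.
have H1 : t <= T M by apply: le_trans tT _; exact: (path_time_le hadm HP).
have H2 : (J m)%:R <= (J M)%:R :> R by rewrite ler_nat (path_leJ HP)// ltnW.
lra.
Qed.

Lemma path_step_small (e : R) : 0 < e ->
  exists M, forall m, (M <= m)%N -> T m.+1 - T m <= e.
Proof.
move=> e0; have [KU|[M HM]] := nat_mono_dichotomy (path_leK HP).
  have [k0 Hk] := step_small hadm e0; have [M kM] := KU k0.
  exists M => m Mm; have [[Km _]|[Km _]] := path_cases HP m.
    rewrite /path_time Km tauS addrAC subrr add0r; apply: Hk.
    exact: leq_trans kM (path_leK HP Mm).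
  by rewrite /path_time Km subrr ltW.
by exists M => m Mm; rewrite /path_time !HM ?leqW// subrr ltW.
Qed.

Lemma fhat_split t : step_integral h (fhat phi h) t = N t + I t.
Proof. by rewrite step_integralB subrK. Qed.

Lemma psi_increment s t j : hdom psi (s, j) -> hdom psi (t, j) ->
  hval psi t j - hval psi s j = (I t - I s) + (N t - N s).
Proof.
move=> ds dt; rewrite (interpolated_increment hadm HP HE ds dt) !fhat_split.
by rewrite opprD addrACA addrC.
Qed.

(** The strict inequality [r < T m.+1] rules out jumps, which take no time. *)
Lemma flow_index r t j : hdom psi (r, j) -> hdom psi (t, j) -> r < t ->
  exists m, [/\ J m = j, K m.+1 = (K m).+1, T m <= r & r < T m.+1].
Proof.
move=> dr dt rt; have [m [Jm Tr rT]] := (dom_iff _ _).1 dr.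
have flow m' : J m' = j -> T m' <= r -> K m'.+1 = (K m').+1.
  move=> Jm' Tr'; have [[]//|[Km' Jm1]] := path_cases HP m'.
  have dT : hdom psi (T m'.+1, j.+1).
    by apply/dom_iff; exists m'.+1; rewrite Jm1 Jm' lexx (path_time_le hadm HP).
  have := interpolated_mono hadm HP HE dt dT (leqnn _).
  rewrite (jump_time _ HP)// => tT; move: (lt_le_trans rt tT).
  by rewrite ltNge Tr'.
have Km := flow _ Jm Tr.
case: (ltP r (T m.+1)) => [rT'|Tr1]; first by exists m.
have Jm1 : J m.+1 = j by rewrite (flow_step HP Km).
exists m.+1; split => //; first exact: flow.
have Km2 := flow _ Jm1 Tr1.
apply: le_lt_trans rT _; rewrite {2}/path_time Km2 tauS ltrDl.
by case: hadm => + _ _; apply.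
Qed.

Lemma noise_window (th e : R) : 0 < e -> exists2 kappa : R, 0 < kappa & forall s t i j,
  kappa <= s + i%:R -> hdom psi (s, i) -> hdom psi (t, j) -> s <= t -> t <= s + th ->
  `|N t - N s| <= e.
Proof.
move=> e0; have e2 : 0 < e / 2 by rewrite divr_gt0.
have [M1 H1] := tracks_noise HT (`|th| + 1) e2.
have [M2 H2] := @path_step_small 1 ltr01.
have [kappa k0 Hk] := late_index (maxn M1 M2).
exists kappa => // s t i j ks ds dt st ts.
have [m [Jm Ts sT]] := (dom_iff _ _).1 ds.
have [m' [_ _ tT]] := (dom_iff _ _).1 dt.
have Mm : (maxn M1 M2 <= m)%N by apply: Hk Ts sT _; rewrite Jm.
have Mm1 := leq_trans (leq_maxl _ _) Mm.
have := H2 _ (leq_trans (leq_maxr _ _) Mm) => step.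
have thn := ler_norm th.
have A1 : `|N t - N (T m)| <= e / 2.
  apply: H1 => //; [exact: le_trans Ts st|lra|by exists m'.+1].
have A2 : `|N s - N (T m)| <= e / 2.
  apply: H1 => //; [have := normr_ge0 th; lra|by exists m.+1].
rewrite -(subrKA (N (T m))) -[N (T m) - _]opprB.
by apply: le_trans (ler_normB _ _) _; lra.
Qed.

(** The increment within one step is noise plus [f] times the length of the step. *)
Lemma near_state (e : R) : 0 < e -> exists M, forall m t, (M <= m)%N ->
  T m <= t -> t <= T m.+1 -> `|hval psi t (J m) - X m| <= e.
Proof.
move=> e0; have e2 : 0 < e / 2 by rewrite divr_gt0.
have [Mf Mf0 HMf] := tracks_bounded HT.
have [M1 H1] := tracks_noise HT 1 e2.
have [M2 H2] := @path_step_small 1 ltr01.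
have [M3 H3] := @path_step_small (e / 2 / Mf) (divr_gt0 e2 Mf0).
exists (maxn M1 (maxn M2 M3)) => m t; rewrite !geq_max => /and3P[m1 m2 m3] Tt tT.
have dt : hdom psi (t, J m) by apply/dom_iff; exists m.
have dT : hdom psi (T m, J m).
  by apply/dom_iff; exists m; rewrite lexx (path_time_le hadm HP).
rewrite -(interpolated_path hadm HP HE m) psi_increment//.
apply: le_trans (ler_normD _ _) _.
have A1 : `|N t - N (T m)| <= e / 2.
  by apply: H1 => //; [have := H2 _ m2; lra|exists m.+1].
have A2 : `|I t - I (T m)| <= Mf * (t - T m).
  by apply: step_integral_lipschitz => //; exact: path_time_ge0.
have A3 : Mf * (t - T m) <= e / 2.
  rewrite mulrC -ler_pdivlMr//; have := H3 _ m3; lra.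
lra.
Qed.

Lemma flow_near (e : R) : 0 < e -> exists2 kappa : R, 0 < kappa & forall m t,
  kappa <= t + (J m)%:R -> T m <= t -> t <= T m.+1 -> K m.+1 = (K m).+1 ->
  exists x y, [/\ flow_set H x, flow_map H x y, `|hval psi t (J m) - x| <= e &
    `|f (K m) - y| <= e].
Proof.
move=> e0; have e2 : 0 < e / 2 by rewrite divr_gt0.
have [M1 H1] := near_state e2; have [M2 H2] := tracks_flow HT e2.
have [kappa k0 Hk] := late_index (maxn M1 M2).
exists kappa => // m t kt Tt tT Km.
have Mm := Hk _ _ Tt tT kt.
have [x [y [Cx Fxy xX yf]]] := H2 _ (leq_trans (leq_maxr _ _) Mm) Km.
have tX := H1 _ _ (leq_trans (leq_maxl _ _) Mm) Tt tT.
exists x, y; split => //; last by lra.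
by rewrite -(subrKA (X m)); apply: le_trans (ler_normD _ _) _; lra.
Qed.

Lemma jump_index t j : hdom psi (t, j) -> hdom psi (t, j.+1) ->
  exists m, [/\ J m = j, J m.+1 = j.+1, T m = t & T m.+1 = t].
Proof.
move=> dt dt1; have [m1 [Jm1 T1 T1']] := (dom_iff _ _).1 dt1.
have [m0 [Jm0 JS mm]] : exists m0, [/\ J m0 = j, J m0.+1 = j.+1 & (m0.+1 <= m1)%N].
  elim: m1 Jm1 {T1 T1'} => [|m IH]; first by case: HP => _ ->.
  have [[_ ->]|[_ Jm]] := path_cases HP m.
    by move=> /IH[m0 [? ? ?]]; exists m0; split => //; exact: leqW.
  by move=> Jm'; exists m; split => //; move: Jm'; rewrite Jm => -[].
have TE : T m0.+1 = T m0 by apply: (jump_time h HP); rewrite JS Jm0.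
have d0 : hdom psi (T m0, j.+1).
  by apply/dom_iff; exists m0.+1; rewrite JS TE lexx -TE (path_time_le hadm HP).
have tE : t = T m0.
  apply/eqP; rewrite eq_le (interpolated_mono hadm HP HE dt d0)//= -TE.
  by apply: le_trans T1; exact: (path_time_le hadm HP).
by exists m0; rewrite TE -tE.
Qed.

Lemma jump_near (e : R) : 0 < e -> exists2 kappa : R, 0 < kappa & forall t j,
  kappa <= t + j%:R -> hdom psi (t, j) -> hdom psi (t, j.+1) ->
  exists x y, [/\ jump_set H x, jump_map H x y, `|hval psi t j - x| <= e &
      `|hval psi t j.+1 - y| <= e].
Proof.
move=> e0; have [M HM] := tracks_jump HT e0; have [kappa k0 Hk] := late_index M.
exists kappa => // t j kt d0 d1; have [m [Jm Jm1 Tm Tm1]] := jump_index d0 d1.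
have Mm : (M <= m)%N by apply: (Hk _ t); rewrite ?Tm ?Tm1 ?Jm.
have [|x [y [? ? ? ?]]] := HM _ Mm; first by rewrite Jm1 Jm.
exists x, y; split => //.
  by rewrite -Tm -Jm (interpolated_path hadm HP HE).
by rewrite -Tm1 -Jm1 (interpolated_path hadm HP HE).
Qed.

Lemma initial_near (e : R) : 0 < e -> exists2 kappa : R, 0 < kappa & forall s j,
  kappa <= s + j%:R -> hdom psi (s, j) ->
  exists x, (flow_set H `|` jump_set H) x /\ `|hval psi s j - x| <= e.
Proof.
move=> e0; have [k1 k10 H1] := flow_near e0; have [k2 k20 H2] := jump_near e0.
exists (Num.max k1 k2); first by rewrite lt_max k10.
move=> s j; rewrite ge_max => /andP[ks1 ks2] ds.
have [m [Jm Ts sT]] := (dom_iff _ _).1 ds.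
have [[Km _]|[Km Jm1]] := path_cases HP m.
  have [|x [y [? ? ? ?]]] := H1 _ s _ Ts sT Km; first by rewrite Jm.
  by exists x; split; [left|rewrite -Jm].
have Tm1 : T m.+1 = T m by exact: jump_time Jm1.
have sE : s = T m by apply/eqP; rewrite eq_le Ts -Tm1 sT.
have ds1 : hdom psi (s, j.+1).
  apply/dom_iff; exists m.+1; rewrite Jm1 Jm Tm1 Ts; split => //.
  by rewrite sE -Tm1 (path_time_le hadm HP).
by have [x [y [? ? ? ?]]] := H2 _ _ ks2 ds ds1; exists x; split; [right|].
Qed.

Lemma interpolated_progress s i r : hdom psi (s, i) -> 0 <= r -> exists t j,
    [/\ hdom psi (t, j), s <= t, (i <= j)%N &
        s + i%:R + r <= t + j%:R <= s + i%:R + r + 1].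
Proof.
move=> ds r0; have [m0 [Jm0 Ts sT]] := (dom_iff _ _).1 ds.
(* [m] is the first step that reaches the level [v]. *)
set v := s + i%:R + r; have [m1 Hm1] := level_unbounded v.
have mono m m' : (m <= m')%N -> T m + (J m)%:R <= T m' + (J m')%:R.
  by move=> mm; rewrite lerD ?ler_nat ?(path_leJ HP)// (path_time_le hadm HP).
have [d Hd] : exists d, v <= T (m0 + d).+1 + (J (m0 + d).+1)%:R.
  by exists m1; apply: le_trans Hm1 (mono _ _ _); rewrite leqW// leq_addl.
have [m [mm Tmv Jmv vm ]] : exists m, [/\ (m0 <= m)%N,
    Num.max s (T m) <= T m.+1, Num.max s (T m) + (J m)%:R <= v &
    v <= T m.+1 + (J m.+1)%:R].
  elim: d Hd => [|d IH] Hd.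
    exists m0; rewrite addn0 in Hd; rewrite (max_idPl Ts) sT Jm0; split => //.
    by rewrite /v lerDl.
  case: (leP v (T (m0 + d).+1 + (J (m0 + d).+1)%:R)) => [/IH//|Hv].
  have sTd : s <= T (m0 + d.+1)%N.
    by apply: le_trans sT _; apply: (path_time_le hadm HP); rewrite addnS ltnS leq_addr.
  exists (m0 + d.+1)%N; rewrite leq_addr (max_idPr sTd); split => //.
    exact: (path_time_le hadm HP).
  by rewrite addnS ltW.
have iJ : (i <= J m)%N by rewrite -Jm0 (path_leJ HP).
have [[Km Jm]|[Km Jm]] := path_cases HP m.
  exists (v - (J m)%:R), (J m); rewrite subrK lexx lerDl ler01; split => //.
  - apply/dom_iff; exists m; split => //; last by rewrite Jm in vm; lra.
    by move: Jmv; rewrite -lerBrDr; apply: le_trans; rewrite le_max lexx orbT.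
  - by move: Jmv; rewrite -lerBrDr; apply: le_trans; rewrite le_max lexx.
have TE : T m.+1 = T m by apply: (jump_time h HP).
have sTm : s <= T m by move: Tmv; rewrite TE ge_max => /andP[].
exists (T m), (J m).+1; split => //.
- by apply/dom_iff; exists m.+1; rewrite Jm TE lexx -TE (path_time_le hadm HP).
- exact: leqW.
- move: vm Jmv; rewrite TE Jm (max_idPr sTm) -natr1 => -> /=; lra.
Qed.

Lemma interpolated_bounded : exists B : R, forall t j, hdom psi (t, j) -> `|hval psi t j| <= B.
Proof.
have /bounded_setPle[B B0 HB'] := HB; exists B => t j dt.
have [m [Jm Tt tT]] := (dom_iff _ _).1 dt.
have XB m' : `|X m'| <= B.
  by apply: HB'; exists (K m', J m') => //; apply/HE; exists m'.
have [Jm1|TE] : J m.+1 = J m \/ T m.+1 = T m.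
    by have [[_ ?]|[_ ?]] := path_cases HP m; [left|right; exact: (jump_time h HP)].
  have [TT|TT] := eqVneq (T m.+1) (T m).
    have -> : t = T m by apply/eqP; rewrite eq_le Tt -TT tT.
    by rewrite -Jm (interpolated_path hadm HP HE).
  have dT : hdom psi (T m, J m).
    by apply/dom_iff; exists m; rewrite lexx (path_time_le hadm HP).
  have dT1 : hdom psi (T m.+1, J m).
    by apply/dom_iff; exists m; rewrite lexx (path_time_le hadm HP).
  have Km : K m.+1 = (K m).+1.
    by have [[]//|[]] := path_cases HP m; lia.
  have D0 : 0 < T m.+1 - T m by rewrite subr_gt0 lt_neqAle eq_sym TT (path_time_le hadm HP).
  pose l := (t - T m) / (T m.+1 - T m).
  have l0 : 0 <= l by apply: divr_ge0; rewrite subr_ge0 ?Tt ?(path_time_le hadm HP).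
  have l1 : 0 <= 1 - l by rewrite subr_ge0 ler_pdivrMr// mul1r lerD2r.
  have tk1 : tau h (K m) <= t <= tau h (K m).+1 by rewrite -Km Tt tT.
  have tk2 : tau h (K m) <= T m.+1 <= tau h (K m).+1.
    by rewrite -Km lexx (path_time_le hadm HP).
  have -> : hval psi t j = (1 - l) *: X m + l *: X m.+1.
    rewrite -(interpolated_path hadm HP HE m) -(interpolated_path hadm HP HE m.+1) Jm1 -Jm.
    have E1 := interpolated_increment hadm HP HE dT dT1.
    have dt' : hdom psi (t, J m) by rewrite Jm.
    have E2 := interpolated_increment hadm HP HE dT dt'.
    rewrite (step_integralE hadm _ tk1) addrAC subrr add0r in E2.
    rewrite (step_integralE hadm _ tk2) addrAC subrr add0r in E1.
    rewrite -[LHS](subrK (hval psi (T m) (J m))) E2.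
    rewrite [(1 - l) *: _]scalerBl scale1r -addrA addrC; congr (_ + _).
    rewrite addrC -scalerBr E1 [RHS]scalerA; congr (_ *: _).
    by rewrite -[tau h (K m)]/(T m) /l mulfVK// gt_eqF.
  apply: le_trans (ler_normD _ _) _.
  rewrite [`|l *: _|]normrZ [`|(1 - l) *: _|]normrZ (ger0_norm l0) (ger0_norm l1).
  have := ler_wpM2l l0 (XB m.+1); have := ler_wpM2l l1 (XB m); lra.
have -> : t = T m by apply/eqP; rewrite eq_le Tt -TE tT.
by rewrite -Jm (interpolated_path hadm HP HE).
Qed.

(** Near [x0] the velocities [f] lie, by upper semicontinuity, in a neighbourhood of
    the convex set of values of the flow map at [x0]; so does their average, from
    which the average velocity of the arc differs by integrated noise. *)
Lemma interpolated_slope x0 (eta : R) : hybrid_basic_conditions H ->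
  flow_set H x0 -> 0 < eta -> exists2 rho : R, 0 < rho &
    forall e : R, 0 < e -> exists kappa : R, forall s t j,
    kappa <= s + j%:R -> hdom psi (s, j) -> hdom psi (t, j) -> s < t -> t <= s + 1 ->
    (forall r, s <= r -> r <= t -> `|hval psi r j - x0| < rho) ->
    exists z, flow_map H x0 z /\
      `|hval psi t j - hval psi s j - (t - s) *: z| <= eta * (t - s) + e.
Proof.
move=> [_ [oF lF] _ CF _] Cx0 eta0.
have [_ Fconv] := CF _ Cx0.
have eta2 : 0 < eta / 2 by rewrite divr_gt0.
have [rho0 rho00 Hrho] := osc_usc x0 oF lF eta2.
have r2 : 0 < rho0 / 2 by rewrite divr_gt0.
exists (rho0 / 2) => // e e0.
pose d := Num.min (rho0 / 4) (eta / 2).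
have d0 : 0 < d by rewrite lt_min eta2 divr_gt0.
have [k1 k10 H1] := flow_near d0; have [k2 k20 H2] := noise_window 1 e0.
exists (Num.max k1 k2) => s t j; rewrite ge_max => /andP[ks1 ks2] ds dt st ts1 near0.
(* [A] is the closed [eta]-neighbourhood of the values at [x0]. *)
pose A := [set w | exists2 z, flow_map H x0 z & `|w - z| <= eta].
have s0 : 0 <= s by exact: (interpolated_ge0 hadm HP HE ds).
have [||y [z Fz yz] yE] := @step_integral_mean _ _ h hadm f A s t _ s0 st.
- move=> x y l l01 [x' Fx' xx'] [y' Fy' yy'].
  exists (l *: x' + (1 - l) *: y').
    have := Fconv x' y' (Itv01 (andP l01).1 (andP l01).2).
    by rewrite !inE /= => /(_ Fx' Fy').
  have /andP[l0 l1] := l01; have {}l1 : 0 <= 1 - l by rewrite subr_ge0.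
  rewrite opprD addrACA -!scalerBr; apply: le_trans (ler_normD _ _) _.
  rewrite !normrZ (ger0_norm l0) (ger0_norm l1).
  have := ler_wpM2l l0 xx'; have := ler_wpM2l l1 yy'; lra.
- move=> k kt sk; pose r := Num.max s (tau h k).
  have sr : s <= r by rewrite le_max lexx.
  have rt : r < t by rewrite gt_max st.
  have dr : hdom psi (r, j) := interpolated_convex ds dt sr (ltW rt).
  have [m [Jm Km Tr rT]] := flow_index dr dt rt.
  have KE : K m = k.
    apply/eqP; rewrite eqn_leq; apply/andP; split; rewrite -ltnS ltnNge -(tau_le hadm) -ltNge.
      by apply: le_lt_trans Tr _; rewrite gt_max sk /= tauS ltrDl; case: hadm => + _ _; apply.
    by rewrite -Km; apply: le_lt_trans rT; rewrite le_max lexx orbT.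
  have [|x [y [Cx Fxy xr yf]]] := H1 m r _ Tr (ltW rT) Km.
    by rewrite Jm; apply: le_trans ks1 _; rewrite lerD2r.
  have := near0 r sr (ltW rt); rewrite Jm in xr => rx0.
  have [|z Fz yz] := Hrho x y _ Fxy.
    rewrite -(subrKA (hval psi r j)); apply: le_lt_trans (ler_normD _ _) _.
    rewrite (distrC x).
    have : d <= rho0 / 4 by rewrite ge_min lexx.
    move: xr rx0; lra.
  exists z => //; rewrite -KE -(subrKA y); apply: le_trans (ler_normD _ _) _.
  have : d <= eta / 2 by rewrite ge_min lexx orbT.
  move: yf yz; lra.
exists z; split => //; rewrite psi_increment// yE addrAC -scalerBr.
apply: le_trans (ler_normD _ _) _; apply: lerD.
  rewrite normrZ ger0_norm ?subr_ge0 ?(ltW st)// mulrC ler_wpM2r// subr_ge0.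
  exact: ltW.
exact: (H2 _ _ _ _ ks2 ds dt (ltW st) ts1).
Qed.

Lemma interpolated_arc_tracks : hybrid_basic_conditions H ->
  exists2 L : R, 0 < L & arc_tracks H psi L.
Proof.
move=> hbc; have [Mf Mf0 HMf] := tracks_bounded HT; exists Mf => //; split.
- exact: (interpolated_ge0 hadm HP HE).
- exact: interpolated_convex.
- exact: (interpolated_mono hadm HP HE).
- exact: (interpolated_abut hadm HP HE).
- exact: interpolated_progress.
- exact: interpolated_bounded.
- move=> th e e0; have [kappa _ Hk] := noise_window th e0; exists kappa.
  move=> s t j ks ds dt st ts; rewrite psi_increment//.
  apply: le_trans (ler_normD _ _) _; apply: lerD; last exact: (Hk _ _ _ _ ks ds dt st ts).
  by apply: step_integral_lipschitz => //; exact: (interpolated_ge0 hadm HP HE ds).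
- by move=> e /initial_near[kappa _ Hk]; exists kappa.
- move=> e /flow_near[kappa _ Hk]; exists kappa => s t j ks ds dt st.
  have [m [Jm Km Ts sT]] := flow_index ds dt st.
  have [|x [y [Cx _ xs _]]] := Hk m s _ Ts (ltW sT) Km; first by rewrite Jm.
  by exists x; rewrite -Jm.
- by move=> x0 eta Cx0 eta0; exact: interpolated_slope.
- by move=> e /jump_near[kappa _ Hk]; exists kappa.
Qed.

End Tracking.

(** * Vanishing inflation *)

Lemma locally_affine_derive {R : realType} {n : nat} (f : R -> 'rV[R]_n) (r : R)
    (a : 'rV[R]_n) (d : R) : 0 < d ->
  (forall x, `|x - r| < d -> f x = f r + (x - r) *: a) ->
  derivable f r 1 /\ derive1 f r = a.
Proof.
move=> d0 Hf.
have H : h^-1 *: (f (h + r) - f r) @[h --> (0 : R)^'] --> a.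
  apply: cvg_near_cst; near=> h.
  have h0 : h != 0 by near: h; exact: nbhs_dnbhs_neq.
  rewrite Hf; last by rewrite addrK; near: h; exact: dnbhs0_lt.
  by rewrite addrAC subrr add0r addrK scalerA mulVf// scale1r.
split; last by apply/cvg_lim => //; exact: norm_hausdorff.
apply/cvg_ex; exists a.
rewrite [X in X @ _ --> _](_ : _ = fun h => h^-1 *: (f (h + r) - f r))//.
by apply/funext => h /=; rewrite [h%:A]mulr1.
Unshelve. all: by end_near. Qed.

Lemma hmap_complete_level {R : realType} {n : nat} (a : hmap R R n) :
  (forall v : R, exists t j, hdom a (t, j) /\ v <= t + j%:R) -> hmap_complete a.
Proof.
move=> Hl /bounded_setPle[M M0 HM].
have [t [j [d]]] := Hl (2 * M + 1).
have : `|(t, j%:R) : R * R| <= M.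
  by apply: HM; exists (hval a t j); exists j.
rewrite prod_normE ge_max /= => /andP[].
have := ler_norm t; have := ler_norm (j%:R : R); lra.
Qed.

Section Inflation.
Context {R : realType} {n : nat}.
Variables (H : hybrid_data R n) (phi : hmap nat R n) (h : nat -> R).
Variables (K J : nat -> nat) (f : nat -> 'rV[R]_n).
Hypotheses (hadm : admissible h) (HP : lattice_path K J).
Hypothesis (HE : forall k j, hdom phi (k, j) <-> exists m, K m = k /\ J m = j).
Hypothesis (HT : tracks H phi h K J f).
Hypothesis (HB : hmap_bounded phi).

Notation T := (path_time h K).
Notation psi := (interpolated phi h).
Notation N := (step_integral h (fun k => fhat phi h k - f k)).
Notation I := (step_integral h f).

Let dom_iff := interpolated_domP hadm HP HE.

Lemma interpolated_hybrid_arc : hybrid_arc psi.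
Proof.
split; first exact: (interpolated_hybrid_domain hadm HP HE).
move=> t t' j dt dt' tt'.
have [M HM] := step_integral_locally_lipschitz hadm (fhat phi h) t'.
apply: (@lipschitz_abs_continuous _ _ _ _ _ M) => u v tu uv vt'.
have du : hdom psi (u, j) := interpolated_convex dt dt' tu (le_trans uv vt').
have dv : hdom psi (v, j) := interpolated_convex dt dt' (le_trans tu uv) vt'.
rewrite (interpolated_increment hadm HP HE du dv); apply: HM => //.
exact: (interpolated_ge0 hadm HP HE du).
Qed.

Lemma interpolated_complete : hmap_complete psi.
Proof.
apply: hmap_complete_level => v; have [m vm] := level_unbounded hadm HP v.
exists (T m), (J m); split => //; apply/dom_iff; exists m.
by rewrite lexx (path_time_le hadm HP).
Qed.

(** Subtracting the noise integrated since the starting time turns the slope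
    [fhat] of the interpolation into [f]. *)
Definition noise_correction (s : R) (i : nat) (t : R) (j : nat) : 'rV[R]_n := N s - N t.

Notation chi := noise_correction.

Lemma psi_mono s i t j : hdom psi (s, i) -> hdom psi (t, j) ->
  s + i%:R <= t + j%:R -> (i <= j)%N /\ s <= t.
Proof.
move=> ds dt st; case: (ltngtP i j) => ij.
- by split => //; exact: (interpolated_mono hadm HP HE ds dt).
- have ts := interpolated_mono hadm HP HE dt ds ij.
  have : j%:R < i%:R :> R by rewrite ltr_nat.
  by move: ts st; lra.
- by split => //; move: st; rewrite ij lerD2r.
Qed.

Lemma noise_correction_vanishes : vanishing_perturbation psi chi.
Proof.
split.
  move=> s i t1 t2 j [_ d1 _] [_ d2 _] t12.
  have [M HM] := step_integral_locally_lipschitz hadm (fun k => fhat phi h k - f k) t2.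
  apply: (@lipschitz_abs_continuous _ _ _ _ _ M) => u v tu uv vt.
  rewrite /chi opprB addrC subrKA distrC; apply: HM => //.
  exact: le_trans (interpolated_ge0 hadm HP HE d1) tu.
move=> th th0 e e0.
have en0 : 0 < e / n.+1%:R by rewrite divr_gt0.
have [kappa _ Hk] := noise_window hadm HP HE HT th en0; exists kappa => s i ds ks.
apply: ge_ereal_sup => _ [[t j] [[_ dt st] /andP[_ tth]] <-] /=.
rewrite lee_fin; apply: enorm_le_scaled; rewrite /chi -opprB normrN.
have [ij st'] := psi_mono ds dt st.
apply: (Hk _ _ _ _ ks ds dt st').
have : i%:R <= j%:R :> R by rewrite ler_nat.
by rewrite /= in tth *; move: tth; lra.
Qed.

Section Tail.
Variables (Th s : R) (i : nat).
Hypotheses (Th0 : 0 < Th) (ds : hdom psi (s, i)).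
Let pt := perturbed_tail psi chi Th s i.

Lemma perturbed_tail_convex : slices_convex (hdom pt).
Proof.
move=> t u r j /= [t0 dt tT] [u0 du uT] tr ru; split; first exact: le_trans t0 tr.
  by apply: (interpolated_convex dt du); rewrite lerD2l.
by apply: le_trans uT; rewrite lerD2r.
Qed.

Lemma perturbed_tail_domain : hybrid_domain 0 (hdom pt).
Proof.
have chain t j : hdom psi (t, (i + j.+1)%N) -> exists c, [/\ 0 <= c,
    hdom psi (s + c, (i + j)%N), hdom psi (s + c, (i + j.+1)%N),
    forall u, hdom psi (u, (i + j)%N) -> u <= s + c &
    forall u, hdom psi (u, (i + j.+1)%N) -> s + c <= u].
  rewrite addnS => dt; have [c [dc dc1 c1 c2]] := interpolated_abut hadm HP HE dt.
  exists (c - s); rewrite subrKC; split => //; rewrite subr_ge0.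
  by apply: (interpolated_mono hadm HP HE ds dc1); rewrite ltnS leq_addr.
apply: hybrid_domain_slices.
- by rewrite /= addr0 addn0; split => //; rewrite addr0 ltW.
- by move=> t /= [].
- exact: perturbed_tail_convex.
- move=> t j /= [t0 dt tT]; have [c [c0 dc dc1 c1 c2]] := chain _ _ dt.
  have ct : c <= t by rewrite -(lerD2l s); exact: c2.
  exists c; split.
  + by split => //; move: tT; rewrite -natr1; lra.
  + by split => //; move: tT; lra.
  + by move=> u [_ du _]; rewrite -(lerD2l s); exact: c1.
  + by move=> u [_ du _]; rewrite -(lerD2l s); exact: c2.
(* The last slice ends at the next jump time or at the truncation. *)
- move=> t j [/= t0 dt tT] Hn.
  suff [b [Eb bmax]] : exists b, hdom pt (b, j) /\ forall u, hdom pt (u, j) -> u <= b.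
    by exists (fun=> b); split => // u Eu; exists 0%N; exact: bmax.
  have [[w dw]|Hw] := pselect (exists w, hdom psi (w, (i + j.+1)%N)).
    have [c [c0 dc dc1 c1 c2]] := chain _ _ dw.
    have tc : t <= c by rewrite -(lerD2l s); exact: c1.
    exists (Num.min c (Th - j%:R)).
    have tm : t <= Num.min c (Th - j%:R) by rewrite le_min tc lerBrDr.
    split.
      split; first exact: le_trans tm.
        by apply: (interpolated_convex dt dc); rewrite lerD2l// ge_min lexx.
      by rewrite -lerBrDr ge_min lexx orbT.
    move=> u [/= _ du uT]; rewrite le_min lerBrDr uT andbT.
    by rewrite -(lerD2l s); exact: c1.
  have r0 : 0 <= Th - (t + j%:R) by rewrite subr_ge0.
  have [t' [j' [dt' tt' jj' /andP[lev _]]]] := interpolated_progress hadm HP HE dt r0.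
  have j'E : j' = (i + j)%N.
    apply/eqP; rewrite eqn_leq jj' andbT leqNgt; apply/negP => ij.
    have [w _ dw] := slice_down (interpolated_abut hadm HP HE) dt' ij.
    by apply: Hw; exists w; rewrite addnS.
  subst j'; exists (Th - j%:R); split; last by move=> u [/= _ _]; rewrite lerBrDr.
  split; first by rewrite subr_ge0; move: tT t0; lra.
    apply: (interpolated_convex dt dt'); first by rewrite lerD2l lerBrDr.
    by move: lev => /=; lra.
  by rewrite /= subrK.
Qed.

Lemma perturbed_tail_increment t u j : hdom pt (t, j) -> hdom pt (u, j) ->
  hval pt u j - hval pt t j = I (s + u) - I (s + t).
Proof.
move=> [/= _ dt _] [_ du _].
rewrite /= opprD addrACA (psi_increment f hadm HP HE dt du) /chi opprB.
by rewrite [X in _ + X]addrC subrKA -[X in _ + X]opprB addrK.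
Qed.

End Tail.

Lemma fatten_near (A : set 'rV[R]_n) (x y : 'rV[R]_n) (e : R) :
  A x -> `|y - x| <= e / n.+1%:R -> fatten A e y.
Proof. by move=> Ax yx; exists x => //; exact: enorm_le_scaled. Qed.

(** Late truncated tails solve the inflated system.  The perturbed arc moves with
    slope [f] on each flow step, which is close to a value of the flow map at a
    point of the flow set close to the arc. *)
Lemma perturbed_tail_solution (e Th : R) : 0 < e -> 0 < Th ->
  exists2 kappa : R, 0 < kappa & forall s i, hdom psi (s, i) -> kappa <= s + i%:R ->
    solution (inflated e H) (perturbed_tail psi chi Th s i).
Proof.
move=> e0 Th0; have en0 : 0 < e / n.+1%:R by rewrite divr_gt0.
(* Half of [d] for the noise, half for the distance to the data. *)
set d := e / n.+1%:R in en0; have d2 : 0 < d / 2 by rewrite divr_gt0.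
have [k1 k10 Hnoise] := noise_window hadm HP HE HT Th d2.
have [k2 k20 Hflow] := flow_near hadm HP HE HT d2.
have [k3 k30 Hjump] := jump_near hadm HP HE HT d2.
have [k4 k40 Hinit] := initial_near hadm HP HE HT d2.
exists (Num.max (Num.max k1 k2) (Num.max k3 k4)); first by rewrite !lt_max k10.
move=> s i ds; rewrite !ge_max => /andP[/andP[ks1 ks2] /andP[ks3 ks4]].
set pt := perturbed_tail _ _ _ _ _.
have late t j (k : R) : hdom pt (t, j) -> k <= s + i%:R -> k <= s + t + (i + j)%:R.
  move=> [/= t0 _ _]; have : 0 <= j%:R :> R by [].
  by rewrite natrD; lra.
have chi_le t j : hdom pt (t, j) -> `|chi s i (s + t) (i + j)| <= d / 2.
  move=> [/= t0 dt tT]; rewrite /chi distrC.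
  apply: (Hnoise _ _ _ _ ks1 ds dt); first by rewrite lerDl.
  by rewrite lerD2l; apply: le_trans tT; rewrite lerDl.
have near t j x : hdom pt (t, j) -> `|hval psi (s + t) (i + j) - x| <= d / 2 ->
    `|hval pt t j - x| <= d.
  move=> dt; have := chi_le _ _ dt => H1 H2; rewrite /= addrAC.
  apply: le_trans (ler_normD _ _) _; lra.
have [Mf Mf0 HMf] := tracks_bounded HT.
have conv : slices_convex (hdom pt) := @perturbed_tail_convex Th s i.
split.
- split; first exact: perturbed_tail_domain.
  move=> t t' j dt dt' tt'.
  apply: (@lipschitz_abs_continuous _ _ _ _ _ Mf) => u v tu uv vt'.
  have du := conv _ _ _ _ dt dt' tu (le_trans uv vt').
  have dv := conv _ _ _ _ dt dt' (le_trans tu uv) vt'.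
  rewrite (perturbed_tail_increment du dv).
  have -> : v - u = (s + v) - (s + u) by ring.
  apply: step_integral_lipschitz => //; last by rewrite lerD2l.
  by case: du => /= _ du _; exact: (interpolated_ge0 hadm HP HE du).
- have d0 : hdom pt (0, 0%N) by split; rewrite /= ?addr0 ?addn0// ltW.
  have [x [CDx xs]] := Hinit _ _ ks4 ds.
  have xs' : `|hval pt 0 0 - x| <= d by apply: near; rewrite // addr0 addn0.
  by case: CDx => [Cx|Dx]; [left|right]; apply: fatten_near xs'.
- move=> t t' j tt' Hdom.
  (* [B] collects the corners of the interpolation and the two end points. *)
  pose B := range (fun k => if k is k'.+1 then if k' is l.+1 then tau h l - s else t' else t).
  have cB : countable B.
    exact: sub_countable (card_image_le _ _) (countableP _).
  have B0 : (@lebesgue_measure R).-negligible B.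
    exists B; split => //; last exact: countable_lebesgue_measure0.
    exact: countable_measurable.
  apply: negligibleS B0 => r /= Hr; apply: contrapT => HnB; apply: Hr => /andP[tr rt'].
  have dt : hdom pt (t, j) by apply: Hdom; rewrite lexx ltW.
  have dt' : hdom pt (t', j) by apply: Hdom; rewrite lexx ltW.
  have dr : hdom pt (r, j) := conv _ _ _ _ dt dt' tr rt'.
  have {}tr : t < r.
    by rewrite lt_neqAle tr andbT; apply/eqP => rE; apply: HnB; exists 0%N.
  have {}rt' : r < t'.
    by rewrite lt_neqAle rt' andbT; apply/eqP => rE; apply: HnB; exists 1%N.
  have [_ /= pr _] := dr; have [_ /= pt' _] := dt'.
  have srt : s + r < s + t' by rewrite ltrD2l.
  have [m [Jm Km Tr rT]] := flow_index hadm HP HE pr pt' srt.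
  have {}Tr : T m < s + r.
    rewrite lt_neqAle Tr andbT; apply/eqP => rE; apply: HnB.
    by exists (K m).+2 => //; rewrite -[tau h _]/(T m) rE addrAC subrr add0r.
  have [|x [y [Cx Fxy xr yf]]] := Hflow m _ _ (ltW Tr) (ltW rT) Km.
    by rewrite Jm; exact: late.
  rewrite Jm in xr; have {}xr := near _ _ _ dr xr.
  have [dv dE] : derivable (hval pt ^~ j) r 1 /\ derive1 (hval pt ^~ j) r = f (K m).
    pose w := Num.min (Num.min (r - t) (t' - r)) (Num.min (s + r - T m) (T m.+1 - (s + r))).
    have w0 : 0 < w by rewrite !lt_min !subr_gt0 tr rt' Tr.
    apply: (locally_affine_derive w0) => v.
    rewrite !lt_min -!andbA !ltr_norml
      => /and4P[/andP[v1 v2] /andP[v3 v4] /andP[v5 v6] /andP[v7 v8]].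
    have dv : hdom pt (v, j) by apply: (conv _ _ _ _ dt dt'); move: v1 v4; lra.
    apply/eqP; rewrite -subr_eq0 opprD addrA (perturbed_tail_increment dr dv).
    rewrite (@step_integralE _ _ _ hadm f (K m) (s + v)); last first.
      by rewrite -flow_interval//; apply/andP; split; rewrite -?[tau h _]/(T m); move: v5 v8; lra.
    rewrite (@step_integralE _ _ _ hadm f (K m) (s + r)); last first.
      by rewrite -flow_interval// (ltW rT) (ltW Tr).
    rewrite opprD addrACA subrr add0r -scalerBl subr_eq0; apply/eqP.
    by congr (_ *: _); ring.
  split => //; first exact: fatten_near xr.
  rewrite dE; exists y; last first.
    by apply: enorm_le_scaled; apply: le_trans yf _; rewrite -/d; lra.
  apply: subset_closure => A /= [_ HA]; apply: HA.
  exists x => //; split => //; rewrite /ecball /=.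
  by apply: enorm_le_scaled; rewrite distrC.
- move=> t j dt dt1.
  have [_ /= pt0 _] := dt; have [_ /= pt1 _] := dt1; rewrite addnS in pt1.
  have [x [y [Dx Gxy xt yt]]] := Hjump _ _ (late _ _ _ dt ks3) pt0 pt1.
  have {}xt := near _ _ _ dt xt.
  have {}yt : `|hval pt t j.+1 - y| <= d by apply: near => //; rewrite addnS.
  split; first exact: fatten_near xt.
  apply: fatten_near yt; exists x => //; split => //; rewrite /ecball /=.
  by apply: enorm_le_scaled; rewrite distrC.
Qed.

Theorem interpolated_vanishing_inflation : vanishing_inflation_solution H psi.
Proof.
split.
- exact: interpolated_hybrid_arc.
- exact: interpolated_complete.
- have [B HB'] := interpolated_bounded hadm HP HE HB.
  apply/bounded_setPle; exists (`|B| + 1); first by rewrite ltr_wpDl.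
  move=> _ [[t j] dt <-]; apply: le_trans (HB' _ _ dt) _.
  by apply: ler_wpDr => //; exact: ler_norm.
- exists chi; first exact: noise_correction_vanishes.
  exact: perturbed_tail_solution.
Qed.

End Inflation.

(** * Graphical limits of tails *)

Section GraphicalLimit.
Context {R : realType} {n : nat}.
Variables (H : hybrid_data R n) (psi : hmap R R n) (ell : R).
Hypotheses (hbc : hybrid_basic_conditions H) (ell0 : 0 < ell) (Htr : arc_tracks H psi ell).
Variables (s : nat -> R) (q : nat -> nat) (Lim : set (R * R * 'rV[R]_n)).
Hypothesis (Hdom : forall i, hdom psi (s i, q i)).
Hypothesis (Hinf : forall v : R, exists N, forall i, (N <= i)%N -> v <= s i + (q i)%:R).
Hypothesis (Hcvg :
  set_cvg (fun i => sv_graph (sv_tail (sv_of_hmap psi) (s i, (q i)%:R))) Lim).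

Definition tail_dom (i : nat) (t : R) (j : nat) : Prop :=
  0 <= t /\ hdom psi (s i + t, (q i + j)%N).
Definition tail_val (i : nat) (t : R) (j : nat) : 'rV[R]_n :=
  hval psi (s i + t) (q i + j).

Notation D := tail_dom.
Notation V := tail_val.

(** Tails in terms of jump counts: the real second coordinate of the graph is
    eliminated here once and for all. *)
Lemma tail_graphP i t b x :
  sv_graph (sv_tail (sv_of_hmap psi) (s i, (q i)%:R)) ((t, b), x) <->
  exists j, [/\ b = j%:R, D i t j & x = V i t j].
Proof.
split=> [[/= t0 b0 [k [bk dk ->]]]|[j [-> [t0 dt] ->]]].
  have qk : (q i <= k)%N by rewrite -(ler_nat R) -bk lerDl.
  exists (k - q i)%N; rewrite /D /V subnKC//; split => //.
  by rewrite natrB// -bk addrAC subrr add0r.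
by split => //=; exists (q i + j)%N; rewrite natrD.
Qed.

Lemma tail_late (v : R) : exists N, forall i t j, (N <= i)%N -> 0 <= t ->
  v <= s i + t + (q i + j)%:R.
Proof.
have [N HN] := Hinf v; exists N => i t j Ni t0; apply: le_trans (HN i Ni) _.
by rewrite natrD; have : 0 <= j%:R :> R by []; lra.
Qed.

Lemma tail_convex i t u r j : D i t j -> D i u j -> t <= r -> r <= u -> D i r j.
Proof.
move=> [t0 dt] [u0 du] tr ru; split; first exact: le_trans tr.
by apply: (arc_convex Htr dt du); rewrite lerD2l.
Qed.

Lemma lim_inf t b x : Lim ((t, b), x) -> forall e : R, 0 < e ->
  exists N, forall i, (N <= i)%N -> exists u j,
    [/\ `|u - t| < e, `|j%:R - b| < e, D i u j & `|V i u j - x| < e].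
Proof.
case: Hcvg => _ {1}<- HL e e0; have [|N _ HN] := HL (ball ((t, b), x) e).
  exact: nbhsx_ballx.
exists N => i Ni; have [[[u b'] y] [/tail_graphP[j [-> Du ->]] [[H1 H2] H3]]] := HN i Ni.
exists u, j; split => //; rewrite distrC; [exact: H1|exact: H2|].
by move: H3; rewrite -ball_normE.
Qed.

Lemma lim_natural t b x : Lim ((t, b), x) -> 0 <= t /\ exists j, b = j%:R.
Proof.
move=> HL; split.
  apply/ler_addgt0Pr => e e0; have [N HN] := lim_inf HL e0.
  have [u [j [ut _ [u0 _] _]]] := HN N (leqnn _).
  by move: ut; rewrite ltr_norml => /andP[]; lra.
(* Two naturals within 1/4 of [b] coincide, so one of them is arbitrarily close. *)
have h4 : 0 < 1 / 4 :> R by lra.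
have [N HN] := lim_inf HL h4; have [u [j [_ jb _ _]]] := HN N (leqnn _).
exists j; apply/eqP; rewrite -subr_eq0 -normr_le0; apply/ler_addgt0Pr => e e0.
have e4 : 0 < Num.min e (1 / 4) by rewrite lt_min e0.
have [N' HN'] := lim_inf HL e4; have [u' [j' [_ jb' _ _]]] := HN' N' (leqnn _).
move: jb'; rewrite lt_min => /andP[jbe jb4].
suff jj : j = j' by rewrite add0r distrC jj ltW.
have jj : `|j%:R - j'%:R| < 1 :> R.
  rewrite -(subrKA b) -[b - _]opprB; apply: le_lt_trans (ler_normB _ _) _; lra.
apply/eqP; rewrite eqn_leq; move: jj; rewrite ltr_norml => /andP[j1 j2].
by rewrite -ltnS -(ltnS j') -!(ltr_nat R) -!natr1; apply/andP; split; lra.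
Qed.

Lemma lim_inf_nat t j x : Lim ((t, j%:R), x) -> forall e : R, 0 < e ->
  exists N, forall i, (N <= i)%N -> exists u,
    [/\ `|u - t| < e, D i u j & `|V i u j - x| < e].
Proof.
move=> HL e e0; have e1 : 0 < Num.min e 1 by rewrite lt_min e0 ltr01.
have [N HN] := lim_inf HL e1; exists N => i /HN[u [j' []]].
rewrite !lt_min => /andP[ut _] /andP[_ jj] Du /andP[Vx _].
suff jE : j' = j by exists u; rewrite -jE.
apply/eqP; rewrite eqn_leq; move: jj; rewrite ltr_norml => /andP[j1 j2].
by rewrite -ltnS -(ltnS j) -!(ltr_nat R) -!natr1; apply/andP; split; lra.
Qed.

(** Boundedness of the arc turns convergent times into points of the limit. *)
Lemma lim_sup (g : nat -> nat) (u : nat -> R) t j :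
  (forall N, [/\ (N <= g N)%N, `|u N - t| < N.+1%:R^-1 & D (g N) (u N) j]) ->
  exists x, Lim ((t, j%:R), x).
Proof.
move=> Hg; have [B HB] := arc_bounded Htr.
have VB N : [set x : 'rV[R]_n | `|x| <= B] (V (g N) (u N) j).
  by have [_ _ [_ d]] := Hg N; exact: HB.
have [l [r Hr]] := compact_subseq (norm_bounded_compact (M:=B)) VB.
exists l; case: Hcvg => <- _ A /nbhs_ballP[e /= e0 eA] N0.
have [N1 HN1] := invS_small e0; pose N := maxn N0 N1.
have [gN uN dN] := Hg (r N); have [rN VN] := Hr N.
exists (g (r N)); first by apply: leq_trans gN; apply: leq_trans rN; exact: leq_maxl.
exists ((u (r N), j%:R), V (g (r N)) (u (r N)) j); split.
  by apply/tail_graphP; exists j.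
apply: eA; split; [split|] => /=.
- rewrite /ball /= distrC; apply: lt_trans uN _; apply: HN1.
  by apply: leq_trans rN; exact: leq_maxr.
- exact: ballxx.
- by rewrite -ball_normE /ball_/= distrC; apply: lt_trans VN _; apply: HN1; exact: leq_maxr.
Qed.

Lemma lim_sup_freq (B : R) j (P : nat -> R -> Prop) :
  (forall N, exists i u, [/\ (N <= i)%N, u <= B, D i u j & P i u]) ->
  exists t g u, (exists x, Lim ((t, j%:R), x)) /\
    forall N, [/\ (N <= g N)%N, `|u N - t| < N.+1%:R^-1, D (g N) (u N) j & P (g N) (u N)].
Proof.
move=> HF.
have HF' N : exists iu : nat * R, [/\ (N <= iu.1)%N, iu.2 <= B, D iu.1 iu.2 j & P iu.1 iu.2].
  by have [i [u ?]] := HF N; exists (i, u).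
pose c N := sval (cid (HF' N)).
have cP N : [/\ (N <= (c N).1)%N, (c N).2 <= B, D (c N).1 (c N).2 j & P (c N).1 (c N).2].
  by rewrite /c; case: cid.
have cI N : `[0, B]%classic (c N).2 by have [_ cB [c0 _] _] := cP N; rewrite /= in_itv/= c0.
have [t [g Hg]] := compact_subseq (@segment_compact R 0 B) cI.
have Hall N : [/\ (N <= (c (g N)).1)%N, `|(c (g N)).2 - t| < N.+1%:R^-1,
    D (c (g N)).1 (c (g N)).2 j & P (c (g N)).1 (c (g N)).2].
  have [cN _ dN PN] := cP (g N); have [gN uN] := Hg N; split => //.
  exact: leq_trans gN cN.
exists t, (fun N => (c (g N)).1), (fun N => (c (g N)).2); split => //.
apply: (@lim_sup (fun N => (c (g N)).1) (fun N => (c (g N)).2)) => N.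
by have [? ? ? _] := Hall N.
Qed.

Lemma tail_increment (th e : R) : 0 < e -> exists N, forall i u u' j, (N <= i)%N ->
  D i u j -> D i u' j -> `|u' - u| <= th -> `|V i u' j - V i u j| <= ell * `|u' - u| + e.
Proof.
move=> e0; have [kappa Hk] := arc_increment Htr th e0; have [N HN] := tail_late kappa.
exists N => i u u' j Ni.
wlog uu : u u' / u <= u'.
  move=> W Du Du' th1; case: (leP u u') => [uu|/ltW uu]; first exact: W.
  by rewrite distrC (distrC u'); apply: W => //; rewrite distrC.
move=> [u0 du] [u0' du']; rewrite (ger0_norm (_ : 0 <= u' - u)) ?subr_ge0// => th1.
have -> : u' - u = (s i + u') - (s i + u) by ring.
apply: Hk => //; [exact: HN|by rewrite lerD2l|lra].
Qed.

(** The noise vanishes in the limit and leaves only the bound on the velocities.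
    The case [t = t'] makes the limit single-valued. *)
Lemma lim_lipschitz t t' j x x' : Lim ((t, j%:R), x) -> Lim ((t', j%:R), x') ->
  `|x' - x| <= ell * `|t' - t|.
Proof.
move=> HL HL'; apply: (@le_of_le_small_mul _ _ _ (3 + 2 * ell)).
  by rewrite addr_gt0// mulr_gt0.
move=> e e0 e1; have [N1 H1] := lim_inf_nat HL e0; have [N2 H2] := lim_inf_nat HL' e0.
have [N3 H3] := tail_increment (`|t' - t| + 2) e0.
pose i := maxn N1 (maxn N2 N3).
have [u [ut Du Vx]] := H1 i (leq_maxl _ _).
have [u' [ut' Du' Vx']] : exists u, [/\ `|u - t'| < e, D i u j & `|V i u j - x'| < e].
  by apply: H2; rewrite !leq_max leqnn orbT.
have uu : `|u' - u| <= `|t' - t| + 2 * e.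
  have -> : u' - u = (u' - t') + ((t' - t) - (u - t)) by ring.
  apply: le_trans (ler_normD _ _) _.
  by have := ler_normB (t' - t) (u - t); lra.
have VV : `|V i u' j - V i u j| <= ell * `|u' - u| + e.
  by apply: H3 => //; [rewrite !leq_max leqnn !orbT|lra].
have := ler_wpM2l (ltW ell0) uu => uu2.
have -> : x' - x = (x' - V i u' j) + ((V i u' j - V i u j) + (V i u j - x)).
  by rewrite !addrA !subrK.
apply: le_trans (ler_normD _ _) _; rewrite (distrC x').
have := ler_normD (V i u' j - V i u j) (V i u j - x); lra.
Qed.

Lemma lim_fun t j x x' : Lim ((t, j%:R), x) -> Lim ((t, j%:R), x') -> x = x'.
Proof.
move=> /lim_lipschitz HL /HL; rewrite subrr normr0 mulr0 normr_le0 subr_eq0.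
by move=> /eqP.
Qed.

(** Graphical convergence gives some points of the tails close to [(t, j, x)]; the
    increment estimate extends this to all points of the slice at nearby times. *)
Lemma lim_val t j x : Lim ((t, j%:R), x) -> forall e : R, 0 < e ->
  exists N, exists2 d : R, 0 < d & forall i u, (N <= i)%N -> D i u j -> `|u - t| < d ->
    `|V i u j - x| < e.
Proof.
move=> HL e e0; pose d := Num.min 1 (Num.min (e / 4) (e / (8 * ell))).
have e4 : 0 < e / 4 by rewrite divr_gt0.
have d0 : 0 < d by rewrite !lt_min ltr01 e4 divr_gt0// mulr_gt0.
have d1 : d <= 1 by rewrite ge_min lexx.
have d4 : d <= e / 4 by rewrite !ge_min lexx ?orbT.
have dl : ell * (2 * d) <= e / 4.
  have : d <= e / (8 * ell) by rewrite !ge_min lexx ?orbT.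
  rewrite ler_pdivlMr ?mulr_gt0//; lra.
have [N1 H1] := lim_inf_nat HL d0; have [N2 H2] := tail_increment 2 e4.
exists (maxn N1 N2), d => // i u; rewrite geq_max => /andP[Ni1 Ni2] Du ut.
have [v [vt Dv Vx]] := H1 i Ni1.
have uv : `|u - v| <= 2 * d.
  have -> : u - v = (u - t) - (v - t) by ring.
  by apply: le_trans (ler_normB _ _) _; lra.
have VV : `|V i u j - V i v j| <= ell * `|u - v| + e / 4 by apply: H2 => //; lra.
have := ler_wpM2l (ltW ell0) uv => uv2.
rewrite -(subrKA (V i v j)); apply: le_lt_trans (ler_normD _ _) _; lra.
Qed.

Definition lim_arc : hmap R R n :=
  {| hdom := [set p | exists x, Lim ((p.1, p.2%:R), x)];
     hval := fun t j => xget 0 [set x | Lim ((t, j%:R), x)] |}.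

Notation a := lim_arc.

Lemma lim_arcP t j : hdom a (t, j) -> Lim ((t, j%:R), hval a t j).
Proof. by move=> [x Lx] /=; case: xgetP => [y _ //|/(_ x)]. Qed.

Lemma lim_arcE t j x : Lim ((t, j%:R), x) -> hval a t j = x.
Proof. by move=> Lx; apply: (@lim_fun t j) => //; apply: lim_arcP; exists x. Qed.

Lemma lim_arc_graph : Lim = sv_graph (sv_of_hmap a).
Proof.
apply/seteqP; split=> [[[t b] x] Lx|[[t b] x] [j [/= -> dt ->]]]; last exact: lim_arcP.
have [_ [j bj]] := lim_natural Lx; subst b.
by exists j; split; [|exists x|apply/esym; exact: lim_arcE].
Qed.

(** Points of the tails close to [t0] and to [t1] enclose [r]. *)
Lemma lim_arc_inner t0 t1 r j : hdom a (t0, j) -> hdom a (t1, j) -> t0 < r -> r < t1 ->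
  exists N, forall i, (N <= i)%N -> D i r j.
Proof.
move=> /lim_arcP L0 /lim_arcP L1 r0 r1.
have d0 : 0 < r - t0 by rewrite subr_gt0.
have d1 : 0 < t1 - r by rewrite subr_gt0.
have [N0 H0] := lim_inf_nat L0 d0; have [N1 H1] := lim_inf_nat L1 d1.
exists (maxn N0 N1) => i; rewrite geq_max => /andP[Ni0 Ni1].
have [u [ut Du _]] := H0 i Ni0; have [v [vt Dv _]] := H1 i Ni1.
apply: (tail_convex Du Dv).
  by move: ut; rewrite ltr_norml => /andP[_]; lra.
by move: vt; rewrite ltr_norml => /andP[+ _]; lra.
Qed.

Lemma lim_arc_eventually r j : (exists N, forall i, (N <= i)%N -> D i r j) -> hdom a (r, j).
Proof.
move=> [N HN]; apply: (@lim_sup (fun k => k + N)%N (fun=> r)) => k.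
by rewrite leq_addr subrr normr0 invr_gt0; split => //; apply: HN; exact: leq_addl.
Qed.

Lemma lim_arc_convex : slices_convex (hdom a).
Proof.
move=> t0 t1 r j d0 d1; rewrite le_eqVlt => /predU1P[<-//|r0].
rewrite le_eqVlt => /predU1P[->//|r1]; apply: lim_arc_eventually.
exact: lim_arc_inner d0 d1 r0 r1.
Qed.

(** The jump times of the tails cluster at a jump time of the limit. *)
Lemma lim_arc_abut : slices_abut (hdom a).
Proof.
move=> t j dt; have Lt := lim_arcP dt; have [N1 H1] := lim_inf_nat Lt ltr01.
pose P i c := [/\ D i c j.+1, forall u, D i u j -> u <= c & forall u, D i u j.+1 -> c <= u].
have HF N : exists i c, [/\ (N <= i)%N, c <= t + 1, D i c j & P i c].
  pose i := maxn N N1; have [u [ut [u0 du] _]] := H1 i (leq_maxr _ _).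
  rewrite addnS in du; have [c [dc dc1 c1 c2]] := arc_abut Htr du.
  have sc : s i <= c.
    by apply: (arc_mono Htr (Hdom i) dc1); rewrite ltnS leq_addr.
  exists i, (c - s i); rewrite /P /D subrKC; split; first exact: leq_maxl.
  - have := c2 _ du; move: ut; rewrite ltr_norml => /andP[_]; lra.
  - by rewrite subr_ge0.
  - rewrite subr_ge0 addnS; split => // v [_ dv].
      by rewrite lerBrDl; exact: c1.
    by rewrite lerBlDl; apply: c2.
have [c [g [u [dc Hgu]]]] := lim_sup_freq HF.
have Hgu' N : [/\ (N <= g N)%N, `|u N - c| < N.+1%:R^-1 & D (g N) (u N) j.+1].
  by have [? ? _ [? _ _]] := Hgu N.
have dc1 := lim_sup Hgu'; exists c; split => // v /lim_arcP Lv.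
  apply: (@le_of_le_small_mul _ _ _ 2) => // e e0 _; have [N2 H2] := lim_inf_nat Lv e0.
  have [N3 H3] := invS_small e0; pose N := maxn N2 N3.
  have [gN uN Dg [_ c1 _]] := Hgu N.
  have [w [wv Dw _]] := H2 (g N) (leq_trans (leq_maxl _ _) gN).
  have := c1 _ Dw; move: (lt_trans uN (H3 N (leq_maxr _ _))) wv; rewrite !ltr_norml.
  by move=> /andP[_ ?] /andP[? _]; lra.
apply: (@le_of_le_small_mul _ _ _ 2) => // e e0 _; have [N2 H2] := lim_inf_nat Lv e0.
have [N3 H3] := invS_small e0; pose N := maxn N2 N3.
have [gN uN Dg [_ _ c1]] := Hgu N.
have [w [wv Dw _]] := H2 (g N) (leq_trans (leq_maxl _ _) gN).
have := c1 _ Dw; move: (lt_trans uN (H3 N (leq_maxr _ _))) wv; rewrite !ltr_norml.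
by move=> /andP[? _] /andP[_ ?]; lra.
Qed.

Lemma lim_arc_origin : hdom a (0, 0%N).
Proof.
apply: lim_arc_eventually; exists 0%N => i _; split => //.
by rewrite addr0 addn0.
Qed.

(** A last slice of the limit is unbounded: the tails keep progressing, and not
    by jumps, since late jumps at bounded times would survive in the limit. *)
Lemma lim_arc_last t j : hdom a (t, j) -> (forall u, ~ hdom a (u, j.+1)) ->
  forall m : nat, hdom a (t + m.+1%:R, j).
Proof.
move=> dt Hn m; have Lt := lim_arcP dt; have [N1 H1] := lim_inf_nat Lt ltr01.
have [N2 H2] : exists N, forall i u, (N <= i)%N -> u <= t + m.+1%:R + 3 -> ~ D i u j.+1.
  apply: contrapT => Hc.
  have HF N : exists i u, [/\ (N <= i)%N, u <= t + m.+1%:R + 3, D i u j.+1 & True].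
    apply: contrapT => Hc'; apply: Hc; exists N => i u Ni ub Du; apply: Hc'.
    by exists i, u.
  by have [c [_ [_ [dc _]]]] := lim_sup_freq HF; exact: Hn dc.
apply: lim_arc_eventually; exists (maxn N1 N2) => i; rewrite geq_max => /andP[Ni1 Ni2].
have [u [ut Du _]] := H1 i Ni1; have [u0 du] := Du.
have r0 : 0 <= m.+1%:R + 1 :> R by rewrite addr_ge0.
have [t' [j' [dt' ut' jj' /andP[l1 l2]]]] := arc_progress Htr du r0.
have /andP[ut1 ut2] : -1 < u - t < 1 by rewrite -ltr_norml.
have j'j : j' = (q i + j)%N.
  apply/eqP; rewrite eqn_leq jj' andbT leqNgt; apply/negP => jlt.
  rewrite -addnS in jlt; have [w wt' dw] := slice_down (arc_abut Htr) dt' jlt.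
  have sw : s i <= w.
    by apply: (arc_mono Htr (Hdom i) dw); rewrite addnS ltnS leq_addr.
  apply: (H2 i (w - s i) Ni2); last by rewrite /D subrKC subr_ge0.
  have : (q i + j)%:R <= j'%:R :> R by rewrite ler_nat.
  by move: l2; lra.
subst j'; have D' : D i (t' - s i) j by rewrite /D subrKC subr_ge0; split => //; lra.
apply: (tail_convex Du D').
  have m1 : 1 <= m.+1%:R :> R by rewrite ler1n.
  by lra.
by move: l1; lra.
Qed.

Lemma lim_arc_domain : hybrid_domain 0 (hdom a).
Proof.
apply: hybrid_domain_slices.
- exact: lim_arc_origin.
- by move=> t /lim_arcP /lim_natural[].
- exact: lim_arc_convex.
- exact: lim_arc_abut.
move=> t j dt Hn; exists (fun m => t + m.+1%:R); split.
- exact: lim_arc_last.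
- by move=> m; rewrite lerD2l ler_nat.
- move=> u _; exists (Num.truncn (u - t)); rewrite addrC -lerBlDr ltW//.
  exact: truncnS_gt.
Qed.

Lemma lim_arc_lipschitz u v j : hdom a (u, j) -> hdom a (v, j) -> u <= v ->
  `|hval a v j - hval a u j| <= ell * (v - u).
Proof.
move=> /lim_arcP Lu /lim_arcP Lv uv; apply: le_trans (lim_lipschitz Lu Lv) _.
by rewrite ger0_norm ?subr_ge0.
Qed.

Lemma lim_arc_hybrid_arc : hybrid_arc a.
Proof.
split; first exact: lim_arc_domain.
move=> t t' j dt dt' tt'; apply: (@lipschitz_abs_continuous _ _ _ _ _ ell) => u v tu uv vt'.
apply: lim_arc_lipschitz => //; apply: (lim_arc_convex dt dt') => //.
  exact: le_trans uv vt'.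
exact: le_trans tu uv.
Qed.

(** Each tail reaches the level [r] in hybrid time within one unit; such points are
    bounded, and infinitely many have the same number of jumps. *)
Lemma lim_arc_complete : hmap_complete a.
Proof.
apply: hmap_complete_level => v; pose r := `|v|.
have r0 : 0 <= r by exact: normr_ge0.
have Hk i : exists k : nat, exists u : R, D i u k /\ r <= u + k%:R <= r + 1.
  have [t [j [dt st qj lev]]] := arc_progress Htr (Hdom i) r0.
  exists (j - q i)%N, (t - s i); rewrite /D subrKC subnKC// subr_ge0.
  by split => //; rewrite natrB//; move: lev => /andP[]; lra.
pose k i := sval (cid (Hk i)).
have kP i : exists u : R, D i u (k i) /\ r <= u + (k i)%:R <= r + 1.
  by rewrite /k; case: cid.
have kI N : `[0, r + 1]%classic (k N)%:R.
  have [u [[u0 _] /andP[_ ul]]] := kP N; rewrite /= in_itv/= ler0n/=; lra.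
have [l [g Hg]] := compact_subseq (@segment_compact R 0 (r + 1)) kI.
(* From index 2 on the distance to [l] is at most 1/3, so these naturals agree. *)
have kE N : (1 < N)%N -> k (g N) = k (g 2).
  move=> N1; have [_ H1] := Hg N; have [_ H2] := Hg 2%N.
  have i3 : N.+1%:R^-1 <= 3^-1 :> R by rewrite lef_pV2 ?posrE// ler_nat.
  have h3 : 3^-1 < 1 / 2 :> R by lra.
  have {}H1 := lt_trans (lt_le_trans H1 i3) h3; have {}H2 := lt_trans H2 h3.
  have jj : `|(k (g N))%:R - (k (g 2))%:R| < 1 :> R.
    rewrite -(subrKA l) -[l - _]opprB; apply: le_lt_trans (ler_normB _ _) _; lra.
  apply/eqP; rewrite eqn_leq; move: jj; rewrite ltr_norml => /andP[j1 j2].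
  by rewrite -ltnS -(ltnS (k (g 2))) -!(ltr_nat R) -!natr1; apply/andP; split; lra.
pose k0 := k (g 2).
have HF N : exists i u, [/\ (N <= i)%N, u <= r + 1, D i u k0 & r <= u + k0%:R].
  pose N' := maxn N 2; have [u [Du /andP[l1 l2]]] := kP (g N').
  rewrite kE ?leq_maxr// in Du l1 l2; exists (g N'), u; split => //.
    by apply: leq_trans (Hg N').1; exact: leq_maxl.
  by have : 0 <= (k (g 2))%:R :> R by []; lra.
have [t [g' [u [dt Hu]]]] := lim_sup_freq HF.
exists t, k0; split => //; apply: le_trans (ler_norm v) _; rewrite -/r.
apply/ler_addgt0Pr => e e0; have [N HN] := invS_small e0.
have [_ ut _ lu] := Hu N; have := lt_trans ut (HN N (leqnn _)).
by rewrite ltr_norml => /andP[_]; lra.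
Qed.

Lemma lim_arc_initial : (flow_set H `|` jump_set H) (hval a 0 0%N).
Proof.
have [[cC cD] _ _ _ _] := hbc.
apply: closed_approx; first exact: closedU.
move=> e e0; have e2 : 0 < e / 2 by rewrite divr_gt0.
have [N1 [d d0 H1]] := lim_val (lim_arcP lim_arc_origin) e2.
have [kappa Hk] := arc_initial Htr e2; have [N2 H2] := tail_late kappa.
pose i := maxn N1 N2.
have D0 : D i 0 0 by split => //; rewrite addr0 addn0.
have [x [CDx Vx]] := Hk _ _ (H2 i 0 0%N (leq_maxr _ _) (lexx _)) D0.2.
exists x => //; have := H1 i 0 (leq_maxl _ _) D0; rewrite subrr normr0 => /(_ d0) Va.
rewrite -(subrKA (V i 0 0)); apply: le_lt_trans (ler_normD _ _) _.
by rewrite (distrC x); rewrite -/(V i 0 0) in Vx; lra.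
Qed.

(** Inner points of a slice of the limit are flow points of all late tails. *)
Lemma lim_arc_flow_set t t' r j : hdom a (t, j) -> hdom a (t', j) -> t < r -> r < t' ->
  flow_set H (hval a r j).
Proof.
move=> dt dt' tr rt'; have [[cC _] _ _ _ _] := hbc.
apply: closed_approx => // e e0; have e2 : 0 < e / 2 by rewrite divr_gt0.
have dr := lim_arc_convex dt dt' (ltW tr) (ltW rt').
have [N1 [d d0 H1]] := lim_val (lim_arcP dr) e2.
have [kappa Hk] := arc_flow Htr e2; have [N2 H2] := tail_late kappa.
pose r' := (r + t') / 2.
have rr' : r < r' by rewrite /r'; lra.
have [N3 H3] := lim_arc_inner dt dt' tr rt'.
have [|N4 H4] := lim_arc_inner dt dt' (lt_trans tr rr') (r := r'); first by rewrite /r'; lra.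
pose i := maxn (maxn N1 N2) (maxn N3 N4).
have [Ni1 Ni2 Ni3 Ni4] : [/\ (N1 <= i)%N, (N2 <= i)%N, (N3 <= i)%N & (N4 <= i)%N].
  by rewrite !leq_max !leqnn !orbT.
have Dr := H3 i Ni3; have Dr' := H4 i Ni4.
have [|x [Cx Vx]] := Hk _ _ _ (H2 i r j Ni2 Dr.1) Dr.2 Dr'.2; first by rewrite ltrD2l.
exists x => //; have := H1 i r Ni1 Dr; rewrite subrr normr0 => /(_ d0) Va.
rewrite -(subrKA (V i r j)); apply: le_lt_trans (ler_normD _ _) _.
by rewrite (distrC x); rewrite -/(V i r j) in Vx; lra.
Qed.

(** [arc_slope] in the limit: over a window of length [w], the integrated noise is
    eventually smaller than any multiple of [w]. *)
Lemma lim_arc_slope t t' r j (eta : R) : hdom a (t, j) -> hdom a (t', j) ->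
  t < r -> r < t' -> 0 < eta -> exists2 d : R, 0 < d & forall w, 0 < w -> w < d ->
    exists2 z, flow_map H (hval a r j) z &
      `|hval a (r + w) j - hval a r j - w *: z| <= 2 * eta * w.
Proof.
move=> dt dt' tr rt' eta0.
have Ca := lim_arc_flow_set dt dt' tr rt'.
have [rho rho0 Hrho] := arc_slope Htr Ca eta0.
(* The last bound keeps the tails within [rho] of the limit on the window. *)
pose d := Num.min (Num.min 1 (t' - r)) (rho / (4 * ell)).
have d0 : 0 < d by rewrite !lt_min ltr01 subr_gt0 rt' divr_gt0// mulr_gt0.
exists d => // w w0; rewrite !lt_min => /andP[/andP[w1 wt'] wr].
have ewr : ell * w < rho / 4 by move: wr; rewrite ltr_pdivlMr ?mulr_gt0//; lra.
have r4 : 0 < rho / 4 by rewrite divr_gt0.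
have ew : 0 < eta * w by rewrite mulr_gt0.
have ew2 : 0 < eta * w / 2 by rewrite divr_gt0.
have ew4 : 0 < eta * w / 4 by rewrite divr_gt0.
have [kappa Hk] := Hrho _ ew2; have [N0 H0] := tail_late kappa.
have dr := lim_arc_convex dt dt' (ltW tr) (ltW rt').
have trw : t < r + w by rewrite (lt_trans tr)// ltrDl.
have rwt' : r + w < t' by move: wt'; lra.
have drw := lim_arc_convex dt dt' (ltW trw) (ltW rwt').
have m0 : 0 < Num.min (rho / 4) (eta * w / 4) by rewrite lt_min r4.
have [N1 [d1 d10 H1]] := lim_val (lim_arcP dr) m0.
have [N2 [d2 d20 H2]] := lim_val (lim_arcP drw) ew4.
have [N3 H3] := tail_increment 1 r4.
have [N4 H4] := lim_arc_inner dt dt' tr rt'.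
have [N5 H5] := lim_arc_inner dt dt' trw rwt'.
pose i := maxn (maxn N0 (maxn N1 N2)) (maxn N3 (maxn N4 N5)).
have [Ni0 [Ni1 Ni2 Ni3 Ni4 Ni5]] : (N0 <= i)%N /\
  [/\ (N1 <= i)%N, (N2 <= i)%N, (N3 <= i)%N, (N4 <= i)%N & (N5 <= i)%N].
  by rewrite !leq_max !leqnn !orbT.
have Dr := H4 i Ni4; have Drw := H5 i Ni5.
have := H1 i r Ni1 Dr; rewrite subrr normr0 => /(_ d10); rewrite lt_min => /andP[Va Va'].
have := H2 i (r + w) Ni2 Drw; rewrite subrr normr0 => /(_ d20) Vaw.
have [|||z [Fz Hz]] := Hk _ _ _ (H0 i r j Ni0 Dr.1) Dr.2 Drw.2.
- by rewrite ltrD2l ltrDl.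
- by rewrite addrA lerD2l ltW.
- move=> r' rr' r'w; pose v := r' - s i.
  have -> : r' = s i + v by rewrite /v subrKC.
  have Dv : D i v j by apply: (tail_convex Dr Drw); rewrite /v; move: rr' r'w; lra.
  rewrite -/(V i v j).
  have vr : `|v - r| <= w by rewrite ler_norml /v; move: rr' r'w; lra.
  have VV : `|V i v j - V i r j| <= ell * `|v - r| + rho / 4.
    by apply: H3 => //; apply: le_trans vr (ltW w1).
  have := ler_wpM2l (ltW ell0) vr => vr2.
  rewrite -(subrKA (V i r j)); apply: le_lt_trans (ler_normD _ _) _; lra.
exists z => //; move: Hz.
have -> : s i + (r + w) - (s i + r) = w by ring.
rewrite -/(V i (r + w) j) -/(V i r j) => Hz.
have -> : hval a (r + w) j - hval a r j - w *: z =
    (hval a (r + w) j - V i (r + w) j) +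
    ((V i (r + w) j - V i r j - w *: z) + (V i r j - hval a r j)).
  set v := V i (r + w) j.
  by rewrite [v - _ - _]addrAC subrKA -[v - _ - _]addrA subrKA addrA addrAC.
apply: le_trans (ler_normD _ _) _; rewrite (distrC (hval a (r + w) j)).
have := ler_normD (V i (r + w) j - V i r j - w *: z) (V i r j - hval a r j); lra.
Qed.

(** The difference quotients are within [2 * eta] of the closed set of values of the
    flow map, for every [eta]. *)
Lemma lim_arc_derivative t t' r j : hdom a (t, j) -> hdom a (t', j) ->
  t < r -> r < t' -> derivable (hval a ^~ j) r 1 ->
  flow_map H (hval a r j) (derive1 (hval a ^~ j) r).
Proof.
move=> dt dt' tr rt' /cvg_ex[l Hl].
have [_ [oF _] _ _ _] := hbc.
have {Hl} Hl : h^-1 *: (hval a (h + r) j - hval a r j) @[h --> (0 : R)^'] --> l.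
  move: Hl; rewrite [X in X @ _ --> _ -> _](_ : _ =
    fun h => h^-1 *: (hval a (h + r) j - hval a r j))//.
  by apply/funext => h /=; rewrite [h%:A]mulr1.
have -> : derive1 (hval a ^~ j) r = l by apply/cvg_lim => //; exact: norm_hausdorff.
apply: osc_closed oF _ => e e0.
have e2 : 0 < e / 2 by rewrite divr_gt0.
have e8 : 0 < e / 8 by rewrite divr_gt0.
have [d d0 Hd] := lim_arc_slope dt dt' tr rt' e8.
have [w [w0 wd wl]] : exists w, [/\ 0 < w, w < d &
    `|l - w^-1 *: (hval a (w + r) j - hval a r j)| < e / 2].
  move/cvgrPdist_lt : Hl => /(_ _ e2) /nbhs_ballP[d' /= d'0 Hd'].
  pose w := Num.min d d' / 2.
  have m0 : 0 < Num.min d d' by rewrite lt_min d0.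
  have w0 : 0 < w by rewrite divr_gt0.
  have wm : w < Num.min d d' by rewrite /w; lra.
  move: wm; rewrite lt_min => /andP[wd wd'].
  exists w; split => //; apply: Hd'; last by rewrite gt_eqF.
  by rewrite -ball_normE /ball_/= sub0r normrN gtr0_norm.
have [z Fz Hz] := Hd w w0 wd; exists (hval a r j), z; split => //.
  by rewrite subrr normr0.
rewrite (addrC r) in Hz.
have Hz' : `|w^-1 *: (hval a (w + r) j - hval a r j) - z| <= 2 * (e / 8).
  have -> : w^-1 *: (hval a (w + r) j - hval a r j) - z =
      w^-1 *: (hval a (w + r) j - hval a r j - w *: z).
    by rewrite [RHS]scalerBr (scalerA w^-1 w) mulVf ?gt_eqF// scale1r.
  by rewrite normrZ gtr0_norm ?invr_gt0// ler_pdivrMl// mulrC.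
rewrite distrC -(subrKA (w^-1 *: (hval a (w + r) j - hval a r j))).
by apply: le_lt_trans (ler_normD _ _) _; lra.
Qed.

(** Late tails jump between their points close to [t] in the two slices, hence at
    times close to [t]. *)
Lemma lim_arc_jump t j : hdom a (t, j) -> hdom a (t, j.+1) ->
  jump_set H (hval a t j) /\ jump_map H (hval a t j) (hval a t j.+1).
Proof.
move=> d0 d1; have [[_ cD] _ [oG _] _ _] := hbc.
have key (e : R) : 0 < e -> exists x y, [/\ jump_set H x, jump_map H x y,
    `|x - hval a t j| < e & `|y - hval a t j.+1| < e].
  move=> e0; have e2 : 0 < e / 2 by rewrite divr_gt0.
  have [N1 [w1 w10 H1]] := lim_val (lim_arcP d0) e2.
  have [N2 [w2 w20 H2]] := lim_val (lim_arcP d1) e2.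
  have [kappa Hk] := arc_jump Htr e2; have [N3 H3] := tail_late kappa.
  have w0 : 0 < Num.min w1 w2 by rewrite lt_min w10.
  have [N4 H4] := lim_inf_nat (lim_arcP d0) w0.
  have [N5 H5] := lim_inf_nat (lim_arcP d1) w0.
  pose i := maxn (maxn N1 N2) (maxn N3 (maxn N4 N5)).
  have [Ni1 Ni2 Ni3 Ni4 Ni5] : [/\ (N1 <= i)%N, (N2 <= i)%N, (N3 <= i)%N,
      (N4 <= i)%N & (N5 <= i)%N] by rewrite !leq_max !leqnn !orbT.
  have [u [ut Du _]] := H4 i Ni4; have [v [vt Dv _]] := H5 i Ni5.
  have [v0 dv] := Dv; rewrite addnS in dv.
  have [c [dc dc1 c1 c2]] := arc_abut Htr dv.
  pose c' := c - s i; have cE : s i + c' = c by rewrite /c' subrKC.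
  have uc : u <= c' by rewrite /c' lerBrDl; apply: c1; exact: Du.2.
  have cv : c' <= v by rewrite /c' lerBlDl; exact: c2.
  have c0 : 0 <= c' by apply: le_trans uc; exact: Du.1.
  have ct : `|c' - t| < Num.min w1 w2.
    move: ut vt; rewrite !ltr_norml => /andP[? _] /andP[_ ?]; apply/andP; split; lra.
  move: ct; rewrite lt_min => /andP[ct1 ct2].
  have Dc : D i c' j by split => //; rewrite cE.
  have Dc1 : D i c' j.+1 by split => //; rewrite cE addnS.
  have V1 := H1 i c' Ni1 Dc ct1; have V2 := H2 i c' Ni2 Dc1 ct2.
  have lev := H3 i c' j Ni3 c0; rewrite cE in lev.
  have [x [y [Dx Gxy Vx Vy]]] := Hk _ _ lev dc dc1.
  rewrite /V cE in V1; rewrite /V cE addnS in V2.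
  exists x, y; split => //.
    rewrite -(subrKA (hval psi c (q i + j))); apply: le_lt_trans (ler_normD _ _) _.
    by rewrite (distrC x); lra.
  rewrite -(subrKA (hval psi c (q i + j).+1)); apply: le_lt_trans (ler_normD _ _) _.
  by rewrite (distrC y); lra.
split.
  by apply: closed_approx cD _ => e /key[x [y [? _ ? _]]]; exists x.
by apply: osc_closed oG _ => e /key[x [y [_ ? ? ?]]]; exists x, y.
Qed.

(** Where the Lipschitz limit is differentiable, which is almost everywhere, its
    derivative satisfies the inclusion. *)
Lemma lim_arc_solution : solution H a.
Proof.
split; [exact: lim_arc_hybrid_arc|exact: lim_arc_initial| |exact: lim_arc_jump].
move=> t t' j tt' Hd.
have dt : hdom a (t, j) by apply: Hd; rewrite lexx ltW.
have dt' : hdom a (t', j) by apply: Hd; rewrite lexx ltW.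
have aeD : {ae lebesgue_measure, forall r : R, t < r < t' -> derivable (hval a ^~ j) r 1}.
  apply: (@lipschitz_on_ae_derivable _ _ _ ell) => // u v tu uv vt'.
  apply: lim_arc_lipschitz => //; apply: (lim_arc_convex dt dt') => //.
    exact: le_trans uv vt'.
  exact: le_trans tu uv.
have aeE (c : R) : {ae lebesgue_measure, forall r : R, r <> c}.
  exists [set c]; split => //; first exact: lebesgue_measure_set1.
  by move=> r /= /contrapT.
have aeF := ae_filter_ringOfSetsType (@lebesgue_measure R).
apply: (@filterS3 _ _ aeF _ _ _ _ _ aeD (aeE t) (aeE t')) => r Hr rt rt' /andP[tr rt''].
have {}tr : t < r by rewrite lt_neqAle tr andbT eq_sym; apply/eqP.
have {}rt'' : r < t' by rewrite lt_neqAle rt'' andbT; apply/eqP.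
have dr : derivable (hval a ^~ j) r 1 by apply: Hr; rewrite tr.
split => //; first exact: lim_arc_flow_set dt dt' tr rt''.
exact: lim_arc_derivative dt dt' tr rt'' dr.
Qed.

End GraphicalLimit.

Lemma cvgy_late {R : realType} (u : nat -> R) : u i @[i --> \oo] --> +oo ->
  forall v : R, exists N, forall i, (N <= i)%N -> v <= u i.
Proof. by move=> /cvgryPge Hu v; have [N _ HN] := Hu v; exists N => i Ni; exact: HN. Qed.

Theorem arc_tracks_asymptotic {R : realType} {n : nat} (H : hybrid_data R n)
    (psi : hmap R R n) (ell : R) :
  hybrid_basic_conditions H -> 0 < ell -> arc_tracks H psi ell -> hmap_complete psi ->
  asymptotic_solution H (sv_of_hmap psi).
Proof.
move=> hbc ell0 Htr Hc; split => //.
- by move=> [t b] [x [j [/= -> dt _]]]; split => //; exact: (arc_ge0 Htr dt).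
- have [B HB] := arc_bounded Htr.
  apply/bounded_setPle; exists (`|B| + 1); first by rewrite ltr_wpDl.
  move=> x [[t b] _ [j [/= _ dt ->]]]; apply: le_trans (HB _ _ dt) _.
  by apply: ler_wpDr => //; exact: ler_norm.
move=> p L Hp Hpinf Hcv.
have Hq i : exists q : nat, (p i).2 = q%:R /\ hdom psi ((p i).1, q).
  by have [x [q [? ? _]]] := Hp i; exists q.
pose q i := sval (cid (Hq i)); pose s i := (p i).1.
have qP i : (p i).2 = (q i)%:R /\ hdom psi (s i, q i) by rewrite /q; case: cid.
have Hdom i : hdom psi (s i, q i) by have [] := qP i.
have pE : p = fun i => (s i, (q i)%:R).
  by apply/funext => i; have [<- _] := qP i; rewrite /s -surjective_pairing.
rewrite pE in Hpinf Hcv.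
have Hinf := cvgy_late Hpinf.
exists (lim_arc L); split.
- exact: (lim_arc_solution hbc ell0 Htr Hdom Hinf Hcv).
- exact: (lim_arc_complete Htr Hdom Hcv).
- exact: (lim_arc_graph ell0 Htr Hinf Hcv).
Qed.

(** * The compressed-domain version *)

(** Applied to the tails of the compressed-domain version, which are contained in
    those of the interpolated mapping. *)
Lemma set_cvg_sub {X : topologicalType} (S S' : nat -> set X) (L : set X) :
  (forall i, S i `<=` S' i) -> set_limsup S' `<=` set_limsup S ->
  set_cvg S L -> set_cvg S' L.
Proof.
move=> SS' Hsup [Ls Li].
have Hinf : L `<=` set_liminf S'.
  rewrite -{1}Li => x Hx A /Hx; apply: filterS => i [y [Sy Ay]].
  by exists y; split => //; exact: SS'.
have Hsub : set_liminf S' `<=` set_limsup S'.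
  move=> x Hx A /Hx[N _ HN] M; exists (maxn N M); first exact: leq_maxr.
  by apply: HN; exact: leq_maxl.
have HL : set_limsup S' `<=` L by rewrite -Ls.
split; apply/seteqP; split => //.
- exact: subset_trans Hinf Hsub.
- exact: subset_trans Hsub HL.
Qed.

Section Compressed.
Context {R : realType} {n : nat}.
Variables (H : hybrid_data R n) (phi : hmap nat R n) (h : nat -> R).
Variables (K J : nat -> nat) (f : nat -> 'rV[R]_n).
Hypotheses (hadm : admissible h) (HP : lattice_path K J).
Hypothesis (HE : forall k j, hdom phi (k, j) <-> exists m, K m = k /\ J m = j).
Hypothesis (HT : tracks H phi h K J f).

Notation T := (path_time h K).
Notation X := (path_state phi K J).
Notation psi := (interpolated phi h).
Notation phit := (compressed phi h).

Let dom_iff := interpolated_domP hadm HP HE.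
Let cdom_iff := compressed_domP h HE.

Lemma compressed_complete : hmap_complete phit.
Proof.
apply: hmap_complete_level => v; have [m vm] := level_unbounded hadm HP v.
by exists (T m), (J m); split => //; apply/cdom_iff; exists m.
Qed.

Lemma compressed_sub p x : sv_of_hmap phit p x -> sv_of_hmap psi p x.
Proof.
move=> [j [pj /cdom_iff[m [Jm Tm]] ->]]; exists j; split => //.
  by apply/dom_iff; exists m; rewrite Tm lexx (path_time_le hadm HP).
by rewrite Tm -Jm (compressedE hadm HE) (interpolated_path hadm HP HE).
Qed.

(** Late steps are short and the state hardly moves within them, so every point of a
    tail of the interpolation is close to a point of the path in the same slice. *)
Lemma compressed_limsup (m : nat -> nat) :
  (forall M, exists N, forall i, (N <= i)%N -> (M <= m i)%N) ->
  set_limsup (fun i => sv_graph (sv_tail (sv_of_hmap psi) (T (m i), (J (m i))%:R)))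
  `<=` set_limsup (fun i => sv_graph (sv_tail (sv_of_hmap phit) (T (m i), (J (m i))%:R))).
Proof.
move=> Hm z Hz A /nbhs_ballP[e /= e0 eA] N.
have e2 : 0 < e / 2 by rewrite divr_gt0.
have e4 : 0 < e / 4 by rewrite divr_gt0.
have [M1 H1] := near_state hadm HP HE HT e4.
have [M2 H2] := path_step_small hadm HP e4.
have [N1 HN1] := Hm (maxn M1 M2).
have Hnb : nbhs z (ball (z : R * R * 'rV[R]_n) (e / 2)) by exact: nbhsx_ballx.
have [i] := Hz _ Hnb (maxn N N1).
rewrite geq_max => /andP[Ni Ni1] [[[t b] x] [[/= t0 b0 [j [jE dj xE]]] Hball]].
have := HN1 i Ni1; rewrite geq_max => /andP[Mm1 Mm2].
have Jj : (J (m i) <= j)%N by rewrite -(ler_nat R) -jE lerDl.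
have [m0 [Jm0 T0 T1]] := (dom_iff _ _).1 dj.
(* If step [m0] precedes the start of the tail then [t = 0], and the starting point
   itself will do. *)
have [m' [mm Jm' Tm' Tm1]] : exists m', [/\ (m i <= m')%N, J m' = j,
    T m' <= T (m i) + t & T (m i) + t <= T m'.+1].
  case: (leqP (m i) m0) => [mm|mm]; first by exists m0.
  exists (m i); split => //.
  - apply/eqP; rewrite eqn_leq Jj -Jm0; apply: (path_leJ HP); exact: ltnW.
  - by rewrite lerDl.
  - apply: le_trans T1 _; apply: (path_time_le hadm HP).
    by apply: leq_trans mm _.
exists i => //; exists ((T m' - T (m i), b), X m'); split.
  split => //=; first by rewrite subr_ge0 (path_time_le hadm HP).
  exists j; rewrite subrKC; split => //; first by apply/cdom_iff; exists m'.
  by rewrite -Jm' (compressedE hadm HE).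
apply: eA; apply: ball_split Hball _.
have st := H2 _ (leq_trans Mm2 mm).
split; [split|] => /=.
- rewrite /ball /= ger0_norm; last by lra.
  by lra.
- exact: ballxx.
- rewrite -ball_normE /ball_/= xE -Jm'.
  by apply: le_lt_trans (H1 _ _ (leq_trans Mm1 mm) Tm' Tm1) _; lra.
Qed.

Theorem compressed_asymptotic : asymptotic_solution H (sv_of_hmap psi) ->
  asymptotic_solution H (sv_of_hmap phit).
Proof.
move=> [pos bnd _ Hlim]; split.
- by move=> p [x /compressed_sub psx]; apply: pos; exists x.
- have /bounded_setPle[B B0 HB] := bnd; apply/bounded_setPle; exists B => //.
  by move=> x [p _ /compressed_sub px]; apply: HB; exists p.
- exact: compressed_complete.
move=> p L Hp Hpinf Hcv.
have Hq i : exists m : nat, p i = (T m, (J m)%:R).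
  have [x [j [pj /cdom_iff[m [Jm Tm]] _]]] := Hp i.
  by exists m; rewrite Jm -Tm -pj -surjective_pairing.
pose m i := sval (cid (Hq i)).
have pE : p = fun i => (T (m i), (J (m i))%:R).
  by apply/funext => i; rewrite /m; case: cid.
apply: (Hlim p) => //.
  by move=> i; have [x /compressed_sub px] := Hp i; exists x.
apply: set_cvg_sub Hcv.
  by move=> i [q x] [/= q0 q1 /compressed_sub].
rewrite pE; apply: compressed_limsup => M.
have [kappa _ Hk] := late_index hadm HP M.
rewrite pE in Hpinf; have [N HN] := cvgy_late Hpinf kappa.
exists N => i Ni; apply: (Hk _ (T (m i))) => //; first exact: (path_time_le hadm HP).
exact: HN.
Qed.

End Compressed.

Theorem lemma5p5 (R : realType) (n : nat) (H : hybrid_data R n)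
    (phi : hmap nat R n) (h : nat -> R)
    (HBC : hybrid_basic_conditions H)
    (Hsim : asymptotic_simulation H phi h) :
  asymptotic_solution H (sv_of_hmap (compressed phi h)) /\
  vanishing_inflation_solution H (interpolated phi h) /\
  asymptotic_solution H (sv_of_hmap (interpolated phi h)).
Proof.
have [hadm [hseq [hbd hcomp]] _ _] := Hsim.
have [K [J [HP HE]]] := hybrid_domain_path hseq hcomp.
have [f HT] := simulation_tracks Hsim HP HE.
have [ell ell0 Htr] := interpolated_arc_tracks hadm HP HE HT hbd HBC.
have Hpsi := arc_tracks_asymptotic HBC ell0 Htr (interpolated_complete hadm HP HE).
split; first exact: compressed_asymptotic hadm HP HE HT Hpsi.
by split => //; exact: interpolated_vanishing_inflation hadm HP HE HT hbd.
Qed.
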